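(* Let $K$ be a number field, $\alpha_1,\ldots,\alpha_t\in K^\times$, $G$ a finite abelian group, and $S$ a finite set of places of $K$ such that $S$ contains all archimedean places, $\mathcal{O}_S$ is a principal ideal domain, and $\{\alpha_1,\ldots,\alpha_t\}\subset\mathcal{O}_S^\times$. Let $\psi:I_K/K^\times\to G$ be a continuous homomorphism with $\{\alpha_1,\ldots,\alpha_t\}\subset\mathrm{N}_{L_\psi/K}(I_{L_\psi})$, unramified outside $S$. Let $\gamma_0,\ldots,\gamma_r$ generate $\mathcal{O}_S^\times$, let $e\in\mathbb{N}$ and $k'\ge1$. Let $v_1,\ldots,v_{k'}$ be distinct elements of $T(S;e;\psi;\{\gamma_0,\ldots,\gamma_r\})$ and for each $i$ fix a uniformiser $\pi_i\in\mathcal{O}_{S\cup\{v_i\}}^\times$ at $v_i$. Suppose places $w_1,\ldots,w_{k'}$ and elements $u_1,\ldots,u_{k'}\in K^\times$ are chosen as follows: $u_1=1$ and $w_1\in T(S;e;\{\gamma_0,\ldots,\gamma_r\};\pi_1)\setminus\{v_1,\ldots,v_{k'}\}$; for $2\le j\le k'$, $u_j=\pi_1^{-c_1}\cdots\pi_{j-1}^{-c_{j-1}}$ where $c_1,\ldots,c_{j-1}\in\{0,\ldots,e-1\}$ are such that the elements $\iota(\pi_j)$ and $\iota(\pi_1)^{c_1}\cdots\iota(\pi_{j-1})^{c_{j-1}}$ of $\widehat{\mathcal{O}}_S^\times$ have the same image in $(\mathbb{F}_{w_1}^\times\times\cdots\times\mathbb{F}_{w_{j-1}}^\times)\otimes\mathbb{Z}/e\mathbb{Z}$,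 and $w_j\in T(S;e;\{\gamma_0,\ldots,\gamma_r\};u_j\pi_j)\setminus\{v_1,\ldots,v_{k'},w_1,\ldots,w_{j-1}\}$. Put $G'=(\mathbb{F}_{v_1}^\times\times\mathbb{F}_{w_1}^\times\times\cdots\times\mathbb{F}_{v_{k'}}^\times\times\mathbb{F}_{w_{k'}}^\times)\otimes\mathbb{Z}/e\mathbb{Z}$, let $\rho'_S:\widehat{\mathcal{O}}_S^\times\to G'$ be the map reducing the components at $v_1,w_1,\ldots,v_{k'},w_{k'}$ and tensoring with $\mathbb{Z}/e\mathbb{Z}$ (a characteristic morphism), and let $\rho':I_K/K^\times\to G'$ be the induced epimorphism. Then there is a $\mathbb{Z}/e\mathbb{Z}$-basis $e_1,e_1',\ldots,e_{k'},e_{k'}'$ of $G'$ such that $e_i,e_i'$ is a basis of $\rho'(K_{v_i}^\times)$ for all $1\le i\le k'$.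
   Context: $I_K$ is the idèle group; a continuous homomorphism $\chi:I_K/K^\times\to G$ corresponds by class field theory to an abelian extension $L_\chi/K$, and $\chi_v$ is its restriction to $K_v^\times\subset I_K/K^\times$ (embedded via idèles with component $a$ at $v$ and $1$ elsewhere). $\mathcal{O}_v$ is the valuation ring of $K_v$, $\mathbb{F}_v$ its residue field, $q_v=|\mathbb{F}_v|$, $\mathcal{O}_{S'}=K\cap\bigcap_{v\notin S'}\mathcal{O}_v$. $\mathrm{spl}_S(\psi)$ is the set of places $v\notin S$ with $\psi_v$ trivial. $T(S;e;\psi;\{x_0,\ldots,x_n\})$ is the set of $v\in\mathrm{spl}_S(\psi)$ with $q_v\equiv1\bmod e$, $x_0,\ldots,x_n\in\mathcal{O}_v^\times$ and $x_0,\ldots,x_n$ $e$-th powers in $\mathbb{F}_v^\times$; with $\psi$ replaced by the trivial homomorphism $1$ this defines $T(S;e;1;\{x_0,\ldots,x_n\})$ (all places outside $S$ with these properties). For $y\in K^\times$, $T(S;e;\{x_0,\ldots,x_n\};y)$ is the set of $w\in T(S;e;1;\{x_0,\ldots,x_n\})$ with $y\in\mathcal{O}_w^\times$ and $X^e-y$ irreducible modulo $w$ over $\mathbb{F}_w$. $\widehat{\mathcal{O}}_S^\times=\prod_{v\notin S}\mathcal{O}_v^\times$; $I_S=\prod_{v\in S}K_v^\times\times\widehat{\mathcal{O}}_S^\times$, $p:I_S\to\widehat{\mathcal{O}}_S^\times$ the projection, $\mathcal{O}_S^\times$ diagonally embedded. A characteristic morphism for a finite abelian group $H$ is a continuous epimorphism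 $\rho_S:\widehat{\mathcal{O}}_S^\times\to H$ vanishing on $p(\mathcal{O}_S^\times)$; it induces $\rho:I_K/K^\times\to H$, $xK^\times\mapsto\rho_S(p(x))$ for $x\in I_S$. The embedding $\iota$: for $v_i$, $K_{v_i}^\times=\mathcal{O}_{v_i}^\times\times\pi_i^{\mathbb{Z}}$ is embedded into $\widehat{\mathcal{O}}_S^\times$ by sending $\mathcal{O}_{v_i}^\times$ identically to the $v_i$-component and $\pi_i$ to the element $\iota(\pi_i)$ with $v_i$-component $1$ and $w$-component $\pi_i^{-1}$ for all $w\notin S\cup\{v_i\}$. *)

(* Defs.v *)
From HB Require Import structures.
From mathcomp Require Import all_boot all_order all_algebra all_fingroup all_field.
From mathcomp Require Import generic_quotient ring_quotient.
From mathcomp Require Import finmap all_classical all_reals.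
From mathcomp Require Import topology normedtype sequences Rstruct.
From mathcomp Require Import zify ring lra.

Set Implicit Arguments.
Unset Strict Implicit.
Unset Printing Implicit Defensive.

Import Order.TTheory GRing.Theory Num.Theory.
Import numFieldNormedType.Exports.
Local Open Scope ring_scope.
Local Open Scope quotient_scope.
Local Open Scope classical_set_scope.

Definition R : realType := Rdefinitions.R.

Record absval (F : fieldType) := AbsVal {
  av :> F -> R;
  av_ge0 : forall x, 0 <= av x;
  av_eq0 : forall x, av x = 0 <-> x = 0;
  avM : forall x y, av (x * y) = av x * av y;
  avD : forall x y, av (x + y) <= av x + av y
}.

Section AbsvalTheory.
Context {F : fieldType} (v : absval F).

Lemma av0 : v 0 = 0. Proof. exact/av_eq0. Qed.

Lemma av1 : v 1 = 1.
Proof.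
have n0 : v 1 != 0 by apply/eqP => /av_eq0/eqP; rewrite oner_eq0.
by apply: (mulfI n0); rewrite -avM !mulr1.
Qed.

Lemma avN x : v (- x) = v x.
Proof.
rewrite -mulN1r avM; suff -> : v (-1) = 1 by rewrite mul1r.
apply/eqP; rewrite -(@eqrXn2 _ 2%N) ?ler01 ?av_ge0 //.
by rewrite expr2 -avM mulrNN mul1r av1 expr1n.
Qed.

Lemma av_dist x y : `|v x - v y| <= v (x - y).
Proof.
have h a b : v a - v b <= v (a - b).
  by rewrite lerBlDr; apply: le_trans (avD _ _ _); rewrite subrK.
by have := h x y; have := h y x; rewrite -(avN (y - x)) opprB ler_norml; lra.
Qed.

End AbsvalTheory.

Section ClassicalInverse.
Context {A : comNzRingType}.

Definition classical_inv (x : A) : A := xget x [set y | y * x = 1].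

Lemma classical_mulVr x : (exists y, y * x = 1) -> classical_inv x * x = 1.
Proof. by move=> h; rewrite /classical_inv; case: xgetP => // n; case: h => y /n. Qed.

Lemma classical_invr_out x : ~ (exists y, y * x = 1) -> classical_inv x = x.
Proof. by move=> h; apply: xgetPN => y hy; apply: h; exists y. Qed.

Lemma classical_invr0 : classical_inv 0 = 0.
Proof.
by apply: classical_invr_out => -[y]/esym/eqP; rewrite mulr0 oner_eq0.
Qed.

End ClassicalInverse.

Section Completion.
Context {F : fieldType} (v : absval F).

Definition cauchy_pred : {pred nat -> F} := fun u =>
  `[< forall eps : R, 0 < eps -> exists N : nat, forall m n : nat,
        (N <= m)%N -> (N <= n)%N -> v (u m - u n) < eps >].

Lemma cauchy_bounded u : cauchy_pred u -> exists2 M : R, 0 < M & forall n, v (u n) <= M.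
Proof.
move=> /asboolP /(_ 1 ltr01) [N hN].
pose M := \sum_(i < N.+1) v (u i) + 1.
have sge0 : 0 <= \sum_(i < N.+1) v (u i) by apply: sumr_ge0 => i _; exact: av_ge0.
have hi (i : nat) : (i <= N)%N -> v (u i) <= \sum_(i < N.+1) v (u i).
  move=> iN; have iN1 : (i < N.+1)%N by [].
  by rewrite (bigD1 (Ordinal iN1)) //= lerDl sumr_ge0 // => j _; exact: av_ge0.
exists M => [|n]; first by rewrite /M; lra.
have [nN|/ltnW Nn] := leqP n N; first by have := hi _ nN; rewrite /M; lra.
have := hN n N Nn (leqnn _); have := avD v (u n - u N) (u N); rewrite subrK.
by have := hi N (leqnn _); rewrite /M; lra.
Qed.

Lemma cauchy_subring : subring_closed cauchy_pred.
Proof.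
split=> [|f g|f g].
- apply/asboolP => e e0; exists 0%N => m n _ _.
  by rewrite /GRing.one /= subrr av0.
- move=> /asboolP cf /asboolP cg; apply/asboolP => e e0.
  have e2 : 0 < e / 2 by lra.
  have [N hN] := cf _ e2; have [M hM] := cg _ e2.
  exists (maxn N M) => m n; rewrite !geq_max => /andP[Nm Mm] /andP[Nn Mn].
  have -> : (f - g) m - (f - g) n = (f m - f n) - (g m - g n).
    by rewrite !fctE; ring.
  by apply: le_lt_trans (avD _ _ _) _; rewrite avN; have := hN _ _ Nm Nn;
    have := hM _ _ Mm Mn; lra.
- move=> cf cg; have [A A0 fA] := cauchy_bounded cf.
  have [B B0 gB] := cauchy_bounded cg.
  move: cf cg => /asboolP cf /asboolP cg; apply/asboolP => e e0.
  have eA : 0 < e / 2 / A by rewrite !divr_gt0.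
  have eB : 0 < e / 2 / B by rewrite !divr_gt0.
  have [N hN] := cf _ eB; have [M hM] := cg _ eA.
  exists (maxn N M) => m n; rewrite !geq_max => /andP[Nm Mm] /andP[Nn Mn].
  have -> : (f * g) m - (f * g) n = f m * (g m - g n) + (f m - f n) * g n.
    by rewrite !fctE; ring.
  apply: le_lt_trans (avD _ _ _) _; rewrite !avM.
  have h1 : v (f m) * v (g m - g n) < e / 2.
    apply: (@le_lt_trans _ _ (A * v (g m - g n))).
      by rewrite ler_wpM2r ?av_ge0.
    by rewrite mulrC -ltr_pdivlMr // hM.
  have h2 : v (f m - f n) * v (g n) <= e / 2.
    apply: (@le_trans _ _ (v (f m - f n) * B)).
      by rewrite ler_wpM2l ?av_ge0.
    by rewrite -ler_pdivlMr // ltW // hN.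
  lra.
Qed.

HB.instance Definition _ := GRing.isSubringClosed.Build (nat -> F) cauchy_pred
  cauchy_subring.

Record cauchy_seq := CauchySeq { cseq :> nat -> F; cseqP : cseq \in cauchy_pred }.
HB.instance Definition _ := [isSub for cseq].
HB.instance Definition _ := [Choice of cauchy_seq by <:].
HB.instance Definition _ := [SubChoice_isSubComNzRing of cauchy_seq by <:].

Definition null_pred : {pred cauchy_seq} := fun u =>
  `[< forall eps : R, 0 < eps -> exists N : nat, forall n : nat,
        (N <= n)%N -> v (u n) < eps >].

Lemma null_ideal : idealr_closed null_pred.
Proof.
split.
- by apply/asboolP => e e0; exists 0%N => n _; rewrite /= av0.
- apply/negP => /asboolP /(_ 1 ltr01) [N /(_ N (leqnn _))].
  by rewrite /= /GRing.one /= av1 ltxx.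
- move=> a x y /asboolP nx /asboolP ny; apply/asboolP => e e0.
  have [A A0 aA] := cauchy_bounded (cseqP a).
  have e2 : 0 < e / 2 by lra.
  have eA : 0 < e / 2 / A by rewrite !divr_gt0.
  have [N hN] := nx _ eA; have [M hM] := ny _ e2.
  exists (maxn N M) => n; rewrite geq_max => /andP[Nn Mn].
  have -> : (a * x + y) n = a n * x n + y n by [].
  apply: le_lt_trans (avD _ _ _) _.
  have h1 : v (a n * x n) <= e / 2.
    rewrite avM; apply: (@le_trans _ _ (A * v (x n))).
      by rewrite ler_wpM2r ?av_ge0.
    by rewrite mulrC -ler_pdivlMr // ltW // hN.
  by have := hM _ Mn; lra.
Qed.

HB.instance Definition _ := isIdealr.Build cauchy_seq null_pred null_ideal.

(* K_v: Cauchy sequences modulo null sequences *)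
Definition completion : Type := {ideal_quot null_pred}.
HB.instance Definition _ := GRing.ComNzRing.on completion.

Lemma completion_unit (x : completion) : x != 0 -> exists y, y * x = 1.
Proof.
rewrite -[x]reprK; set u := repr x => x0.
have nu : ~ null_pred u.
  move=> nu; move/eqP: x0; apply; apply/eqP.
  have -> : (0 : completion) = \pi 0 by rewrite pi_zeror.
  by rewrite -Quotient.idealrBE subr0.
have /asboolP cu := cseqP u.
have [d d0 [N hd]] : exists2 d : R, 0 < d &
    exists N, forall n, (N <= n)%N -> d <= v (u n).
  have [e e0 he] : exists2 e : R, 0 < e &
      forall N, exists2 n, (N <= n)%N & e <= v (u n).
    apply: contrapT => h; apply: nu; apply/asboolP => e e0.
    apply: contrapT => h2; apply: h; exists e => // M; apply: contrapT => h3.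
    apply: h2; exists M => n Mn; rewrite ltNge; apply/negP => en.
    by apply: h3; exists n.
  have e2 : 0 < e / 2 by lra.
  have [M hM] := cu _ e2; exists (e / 2) => //; exists M => n Mn.
  have [m Mm em] := he M; have := hM _ _ Mm Mn.
  by have := avD v (u m - u n) (u n); rewrite subrK; lra.
pose w : nat -> F := fun n => (u n)^-1.
have un0 n : (N <= n)%N -> u n != 0.
  by move=> /hd; apply: contraTneq => ->; rewrite av0 -ltNge.
have cw : w \in cauchy_pred.
  apply/asboolP => e e0.
  have ed : 0 < e * d * d by rewrite !mulr_gt0.
  have [M hM] := cu _ ed; exists (maxn N M) => m n.
  rewrite !geq_max => /andP[Nm Mm] /andP[Nn Mn].
  have := hM _ _ Mm Mn.
  have -> : u m - u n = (w m - w n) * (- (u m * u n)).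
    by rewrite /w; field; rewrite !un0.
  rewrite avM avN avM => h; rewrite ltNge; apply/negP => ewv.
  have : e * (d * d) <= v (w m - w n) * (v (u m) * v (u n)).
    by rewrite !ler_pM ?mulr_ge0 ?(ltW d0) ?(ltW e0) ?hd.
  by move: h; rewrite mulrA; lra.
exists (\pi_{ideal_quot null_pred} (CauchySeq cw)).
have -> : \pi_{ideal_quot null_pred} (CauchySeq cw) * \pi u =
    \pi_{ideal_quot null_pred} (CauchySeq cw * u) by rewrite pi_mulr.
have -> : (1 : completion) = \pi 1 by rewrite pi_oner.
apply/eqP; rewrite -Quotient.idealrBE; apply/asboolP => e e0.
exists N => n Nn.
have -> : (CauchySeq cw * u - 1) n = w n * u n - 1 by [].
by rewrite /w mulVf ?un0 // subrr av0.
Qed.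

Lemma completion_mulVf (x : completion) : x != 0 -> classical_inv x * x = 1.
Proof. by move=> /completion_unit/classical_mulVr. Qed.

HB.instance Definition _ := GRing.ComNzRing_isField.Build completion
  completion_mulVf classical_invr0.

Lemma const_cauchy (a : F) : (fun=> a) \in cauchy_pred.
Proof. by apply/asboolP => e e0; exists 0%N => m n _ _; rewrite subrr av0. Qed.

Definition cembed (a : F) : completion :=
  \pi_{ideal_quot null_pred} (CauchySeq (const_cauchy a)).

Lemma cembed_zmod : zmod_morphism cembed.
Proof.
move=> a b; rewrite /cembed.
rewrite -[RHS](@raddfB _ _ \pi_{ideal_quot null_pred}).
by congr (\pi _); exact: val_inj.
Qed.

Lemma cembed_monoid : monoid_morphism cembed.
Proof.
split; last move=> a b; rewrite /cembed.
  by rewrite -[RHS](rmorph1 \pi_{ideal_quot null_pred}); congr (\pi _); exact: val_inj.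
by rewrite -[RHS](rmorphM \pi_{ideal_quot null_pred}); congr (\pi _); exact: val_inj.
Qed.

HB.instance Definition _ := GRing.isZmodMorphism.Build F completion cembed
  cembed_zmod.
HB.instance Definition _ := GRing.isMonoidMorphism.Build F completion cembed
  cembed_monoid.

(* the continuous extension of the absolute value to the completion *)
Definition cabs (x : completion) : R := limn (fun n => v ((repr x : cauchy_seq) n)).

End Completion.

Arguments null_pred {F} v _.
Arguments cabs {F v} x.

Section CabsTheory.
Context {F : fieldType} (v : absval F).
Local Notation pi := (\pi_{ideal_quot (null_pred v)}).

Lemma cauchy_av_cvg (u : cauchy_seq v) : cvgn (fun n => v (u n)).
Proof.
apply/cauchy_cvgP; apply: cauchy_exP => e e0.
have /asboolP /(_ e e0) [N hN] := cseqP u.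
exists (v (u N)); exists N => // n /= Nn.
rewrite /ball /=; apply: le_lt_trans (av_dist _ _ _) _.
exact: hN.
Qed.

Lemma cabs_cvg (u : cauchy_seq v) : v (u n) @[n --> \oo] --> cabs (pi u).
Proof.
set w : cauchy_seq v := repr (pi u).
have nuw : null_pred v (u - w).
  by have : u - w \in null_pred v by rewrite Quotient.idealrBE reprK.
have d0 : (v (u n) - v (w n)) @[n --> \oo] --> (0 : R).
  apply/cvgrPdist_lt => e e0; have /asboolP /(_ e e0) [N hN] := nuw.
  exists N => // n /= Nn; rewrite sub0r normrN.
  exact: le_lt_trans (av_dist _ _ _) (hN _ Nn).
have h := cvgD d0 (@cauchy_av_cvg w : v (w n) @[n --> \oo] --> cabs (pi u)).
rewrite add0r in h; have -> : (fun n => v (u n)) =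
    (fun n => v (u n) - v (w n)) \+ (fun n => v (w n)).
  by apply/funext => n /=; rewrite subrK.
exact: h.
Qed.

Lemma cabs_unique (u : cauchy_seq v) (f : nat -> R) (l : R) :
  (forall n, v (u n) = f n) -> f n @[n --> \oo] --> l -> cabs (pi u) = l.
Proof. by move=> /funext <- h; apply: (cvg_unique _ (@cabs_cvg u) h). Qed.

Lemma cabs_embed a : cabs (cembed v a) = v a.
Proof. by apply: (@cabs_unique _ (fun=> v a)) => //; exact: cvg_cst. Qed.

Lemma cabs_ge0 (x : completion v) : 0 <= cabs x.
Proof.
rewrite -[x]reprK; set u := repr x.
apply: (ler_cvg_to (cvg_cst (0 : R)) (@cabs_cvg u)).
by near=> n; exact: av_ge0.
Unshelve. all: by end_near. Qed.

Lemma cabsM (x y : completion v) : cabs (x * y) = cabs x * cabs y.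
Proof.
rewrite -[x]reprK -[y]reprK; set u := repr x; set w := repr y.
have -> : pi u * pi w = pi (u * w) by rewrite pi_mulr.
apply: cabs_unique (cvgM (@cabs_cvg u) (@cabs_cvg w)) => n.
exact: avM.
Qed.

Lemma cabsN (x : completion v) : cabs (- x) = cabs x.
Proof.
rewrite -[x]reprK; set u := repr x.
have -> : - pi u = pi (- u) by rewrite pi_oppr.
apply: cabs_unique (@cabs_cvg u) => n.
exact: avN.
Qed.

Lemma cabs0 : cabs (0 : completion v) = 0.
Proof. by rewrite -(rmorph0 (cembed v)) cabs_embed av0. Qed.

Lemma cabs1 : cabs (1 : completion v) = 1.
Proof. by rewrite -(rmorph1 (cembed v)) cabs_embed av1. Qed.

Lemma cabsV (x : completion v) : x != 0 -> cabs x^-1 * cabs x = 1.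
Proof. by move=> x0; rewrite -cabsM mulVf // cabs1. Qed.

Lemma cabs_ultra : (forall a b, v (a + b) <= Num.max (v a) (v b)) ->
  forall x y : completion v, cabs (x + y) <= Num.max (cabs x) (cabs y).
Proof.
move=> ult x y; rewrite -[x]reprK -[y]reprK; set u := repr x; set w := repr y.
have -> : pi u + pi w = pi (u + w) by rewrite pi_addr.
apply/ler_addgt0Pr => e e0.
apply: (ler_cvg_to (@cabs_cvg (u + w)) (cvg_cst _)).
have /cvgrPdist_lt /(_ e e0) hu := @cabs_cvg u.
have /cvgrPdist_lt /(_ e e0) hw := @cabs_cvg w.
near=> n.
have -> : (u + w) n = u n + w n by [].
apply: le_trans (ult _ _) _.
have : `|cabs (pi u) - v (u n)| < e by near: n.
have : `|cabs (pi w) - v (w n)| < e by near: n.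
rewrite !ltr_norml !maxEle.
by case: ifP; case: ifP; lra.
Unshelve. all: by end_near. Qed.

End CabsTheory.

(* Normalised discrete valuations; the value at 0 is a dummy, fixed so that
   equal valuations are equal functions. *)
Record fplace (F : fieldType) := FPlace {
  fval :> F -> int;
  fval0 : fval 0 = 0;
  fvalM : forall x y, x != 0 -> y != 0 -> fval (x * y) = fval x + fval y;
  fvalD : forall x y, x != 0 -> y != 0 -> x + y != 0 ->
    Num.min (fval x) (fval y) <= fval (x + y);
  fval_surj : exists2 x, x != 0 & fval x = 1
}.

HB.instance Definition _ F := gen_eqMixin (fplace F).
HB.instance Definition _ F := gen_choiceMixin (fplace F).

Section FiniteAbs.
Context {F : fieldType} (v : fplace F).

Definition fabs (x : F) : R := if x == 0 then 0 else 2 ^ (- v x).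

Lemma fabs_ge0 x : 0 <= fabs x.
Proof. by rewrite /fabs; case: eqP => // _; rewrite exprz_ge0. Qed.

Lemma fabs_eq0 x : fabs x = 0 <-> x = 0.
Proof.
rewrite /fabs; case: eqP => // x0; split=> // /eqP.
by rewrite expfz_eq0 pnatr_eq0 andbF.
Qed.

Lemma fabsM x y : fabs (x * y) = fabs x * fabs y.
Proof.
rewrite /fabs mulf_eq0; case: eqP => [|/eqP] x0; first by rewrite mul0r.
case: eqP => [|/eqP] y0; first by rewrite mulr0.
by rewrite /= fvalM // opprD expfzDr // pnatr_eq0.
Qed.

Lemma fabs_ultra x y : fabs (x + y) <= Num.max (fabs x) (fabs y).
Proof.
have [->|x0] := eqVneq x 0; first by rewrite add0r le_max lexx orbT.
have [->|y0] := eqVneq y 0; first by rewrite addr0 le_max lexx.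
have [xy0|xy0] := eqVneq (x + y) 0.
  by rewrite /fabs xy0 eqxx le_max fabs_ge0.
have := fvalD v x0 y0 xy0.
rewrite /fabs !ifN // ge_min le_max => /orP[] h; apply/orP; [left|right];
  by rewrite ler_weXz2l ?ler1n // lerN2.
Qed.

Lemma fabsD x y : fabs (x + y) <= fabs x + fabs y.
Proof.
apply: le_trans (fabs_ultra _ _) _.
by rewrite ge_max lerDl lerDr !fabs_ge0.
Qed.

Definition fabsval : absval F := AbsVal fabs_ge0 fabs_eq0 fabsM fabsD.

End FiniteAbs.

Record aplace (F : fieldType) := APlace {
  aabs :> absval F;
  aabs_nat : forall n : nat, aabs n%:R = n%:R
}.

(* A place is an equivalence class of nontrivial absolute values. Every class
   has one representative among: the normalised discrete valuations (finite
   places), and the absolute values extending the usual one of the rationals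
   (archimedean places). *)
Inductive place (F : fieldType) := Fin of fplace F | Arch of aplace F.

HB.instance Definition _ F := gen_eqMixin (place F).
HB.instance Definition _ F := gen_choiceMixin (place F).

Definition place_abs F (v : place F) : absval F :=
  match v with Fin w => fabsval w | Arch w => w end.

Definition local_field F (v : place F) : fieldType := completion (place_abs v).

Definition labs F (v : place F) (x : local_field v) : R := cabs x.

Definition embed F (v : place F) : {rmorphism F -> local_field v} :=
  cembed (place_abs v).

Section ValuationRing.
Context {F : fieldType} (v : fplace F).
Local Notation Fv := (local_field (Fin v)).

Lemma labs_ultra (x y : Fv) : labs (x + y) <= Num.max (labs x) (labs y).
Proof. exact: (@cabs_ultra _ (fabsval v) (fabs_ultra v)). Qed.

Definition vring_pred : {pred Fv} := fun x => labs x <= 1.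

Lemma vring_closed : subring_closed vring_pred.
Proof.
split=> [|x y|x y]; rewrite /in_mem /= /vring_pred /labs.
- by rewrite cabs1.
- move=> x1 y1; apply: le_trans (labs_ultra _ _) _.
  by rewrite ge_max /labs cabsN x1.
- by move=> x1 y1; rewrite cabsM mulr_ile1 ?cabs_ge0.
Qed.

HB.instance Definition _ := GRing.isSubringClosed.Build Fv vring_pred
  vring_closed.

Record vring := VRing { vr_val :> Fv; vr_valP : vr_val \in vring_pred }.
HB.instance Definition _ := [isSub for vr_val].
HB.instance Definition _ := [Choice of vring by <:].
HB.instance Definition _ := [SubChoice_isSubComNzRing of vring by <:].

Definition vring_unit : {pred vring} := fun x => `[< exists y, y * x = 1 >].

Lemma vring_mulVx : {in vring_unit, left_inverse 1 classical_inv *%R}.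
Proof. by move=> x /asboolP/classical_mulVr. Qed.

Lemma vring_unitPl (x y : vring) : y * x = 1 -> vring_unit x.
Proof. by move=> h; apply/asboolP; exists y. Qed.

Lemma vring_invr_out : {in [predC vring_unit], classical_inv =1 id}.
Proof. by move=> x /asboolPn/classical_invr_out. Qed.

HB.instance Definition _ := GRing.ComNzRing_hasMulInverse.Build vring
  vring_mulVx vring_unitPl vring_invr_out.

Definition max_ideal : {pred vring} := fun x => labs (vr_val x) < 1.

Lemma max_ideal_closed : idealr_closed max_ideal.
Proof.
split; rewrite /in_mem /= /max_ideal /labs.
- by rewrite cabs0.
- by rewrite cabs1 ltxx.
- move=> a x y x1 y1; apply: le_lt_trans (labs_ultra _ _) _.
  rewrite gt_max; apply/andP; split; last exact: y1.
  rewrite /labs cabsM; apply: le_lt_trans x1.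
  by rewrite ler_piMl ?cabs_ge0 //; exact: vr_valP.
Qed.

HB.instance Definition _ := isIdealr.Build vring max_ideal max_ideal_closed.

Definition residue : Type := {ideal_quot max_ideal}.
HB.instance Definition _ := GRing.ComNzRing.on residue.

Definition to_residue : vring -> residue := \pi_{ideal_quot max_ideal}.

HB.instance Definition _ := GRing.RMorphism.copy to_residue
  (\pi_{ideal_quot max_ideal} : vring -> {ideal_quot max_ideal}).

Lemma residue_unit (x : residue) : x != 0 -> exists y, y * x = 1.
Proof.
rewrite -[x]reprK; set u : vring := repr x => x0.
have nu : ~~ (labs (vr_val u) < 1).
  apply: contra x0 => u1.
  have -> : (0 : residue) = \pi 0 by rewrite pi_zeror.
  by rewrite -Quotient.idealrBE subr0.
have u1 : cabs (vr_val u) = 1.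
  by apply/eqP; rewrite eq_le; apply/andP; split; [exact: vr_valP|rewrite leNgt].
have u0 : vr_val u != 0.
  by apply: contra_eqN u1 => /eqP->; rewrite cabs0 eq_sym oner_eq0.
have uV : (vr_val u)^-1 \in vring_pred.
  by have := cabsV u0; rewrite u1 mulr1 /in_mem /= /vring_pred /labs => ->.
exists (to_residue (VRing uV)); rewrite -[\pi u]/(to_residue u) -rmorphM.
rewrite -[RHS](rmorph1 to_residue); congr to_residue; apply: val_inj => /=.
by rewrite mulVf.
Qed.

Lemma residue_mulVf (x : residue) : x != 0 -> classical_inv x * x = 1.
Proof. by move=> /residue_unit/classical_mulVr. Qed.

HB.instance Definition _ := GRing.ComNzRing_isField.Build residue
  residue_mulVf classical_invr0.

(* q_v; this is 0 should the residue field be infinite, which does not happen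
   for number fields *)
Definition residue_card : nat := #|` fset_set [set: residue]|%fset.

End ValuationRing.

(* Abelian groups are zmodTypes, hence written additively. In particular
   x + y, - x, 0, x *+ n in [unit_group A] are the product, the inverse, 1 and
   the n-th power of units of A. *)
Section UnitGroup.
Context (A : comUnitRingType).

Record unit_group := UnitGroup { uval :> A; uvalP : uval \is a GRing.unit }.
HB.instance Definition _ := [isSub for uval].
HB.instance Definition _ := [Choice of unit_group by <:].

Definition ug_one := UnitGroup (unitr1 A).
Definition ug_mul (x y : unit_group) :=
  UnitGroup (etrans (unitrMr (uval y) (uvalP x)) (uvalP y)).
Definition ug_inv (x : unit_group) :=
  UnitGroup (etrans (unitrV (uval x)) (uvalP x)).

Lemma ug_mulA : associative ug_mul.
Proof. by move=> x y z; apply: val_inj; rewrite /= mulrA. Qed.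
Lemma ug_mulC : commutative ug_mul.
Proof. by move=> x y; apply: val_inj; rewrite /= mulrC. Qed.
Lemma ug_mul1 : left_id ug_one ug_mul.
Proof. by move=> x; apply: val_inj; rewrite /= mul1r. Qed.
Lemma ug_mulV : left_inverse ug_one ug_inv ug_mul.
Proof. by move=> x; apply: val_inj; rewrite /= mulVr // uvalP. Qed.

HB.instance Definition _ := GRing.isZmodule.Build unit_group
  ug_mulA ug_mulC ug_mul1 ug_mulV.

End UnitGroup.

Definition unit_map (A B : comUnitRingType) (f : {rmorphism A -> B})
    (x : unit_group A) : unit_group B :=
  UnitGroup (rmorph_unit f (uvalP x)).

Section ProdGroup.
Context (I : Type) (A : I -> zmodType).

Definition prod_group : Type := forall i, A i.
HB.instance Definition _ := gen_eqMixin prod_group.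
HB.instance Definition _ := gen_choiceMixin prod_group.

Definition pg_add (x y : prod_group) : prod_group := fun i => x i + y i.
Definition pg_opp (x : prod_group) : prod_group := fun i => - x i.
Definition pg_zero : prod_group := fun=> 0.

Lemma pg_addA : associative pg_add.
Proof. by move=> x y z; apply: functional_extensionality_dep => i; exact: addrA. Qed.
Lemma pg_addC : commutative pg_add.
Proof. by move=> x y; apply: functional_extensionality_dep => i; exact: addrC. Qed.
Lemma pg_add0 : left_id pg_zero pg_add.
Proof. by move=> x; apply: functional_extensionality_dep => i; exact: add0r. Qed.
Lemma pg_addN : left_inverse pg_zero pg_opp pg_add.
Proof. by move=> x; apply: functional_extensionality_dep => i; exact: addNr. Qed.

HB.instance Definition _ := GRing.isZmodule.Build prod_group
  pg_addA pg_addC pg_add0 pg_addN.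

End ProdGroup.

Section TensorZ.
Context (A : zmodType) (e : nat).

Definition multiples : {pred A} := fun x => `[< exists y, x = y *+ e >].

Lemma multiples_closed : zmod_closed multiples.
Proof.
split=> [|x y /asboolP[x' ->] /asboolP[y' ->]]; apply/asboolP.
  by exists 0; rewrite mul0rn.
by exists (x' - y'); rewrite mulrnBl.
Qed.

HB.instance Definition _ := GRing.isZmodClosed.Build A multiples multiples_closed.

(* the tensor product of A with Z/eZ, that is A/eA *)
Definition tensorZ : Type := {ideal_quot multiples}.
HB.instance Definition _ := GRing.Zmodule.on tensorZ.

Definition to_tensorZ : A -> tensorZ := \pi_{ideal_quot multiples}.

End TensorZ.

(* b is a basis of the Z/eZ-module M, a subgroup of A killed by e *)
Definition basis_mod (A : zmodType) (e : nat) (M : set A) (I : finType)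
    (b : I -> A) : Prop :=
  (forall i, M (b i)) /\
  (forall x, M x -> exists! c : {ffun I -> 'I_e}, x = \sum_i b i *+ c i).

Section Ideles.
Context (F : fieldType).

Definition idele_pred :
    {pred prod_group (fun v : place F => unit_group (local_field v))} :=
  fun x => `[< finite_set [set v : fplace F | labs (uval (x (Fin v))) <> 1] >].

Lemma idele_closed : zmod_closed idele_pred.
Proof.
split=> [|x y /asboolP xf /asboolP yf]; apply/asboolP.
  rewrite (_ : [set _ | _] = set0) //; apply/seteqP; split=> // v /=.
  by rewrite /labs cabs1.
apply: sub_finite_set (_ : finite_set (_ `|` _)); last first.
  by rewrite finite_setU; split; [exact: xf|exact: yf].
move=> v /=; apply: contra_notP => /not_orP[/contrapT xv /contrapT yv].
move: xv yv; rewrite /labs /= cabsM => -> yv; rewrite mul1r.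
have y0 : uval (y (Fin v)) != 0 by rewrite -unitfE uvalP.
by have := cabsV y0; rewrite yv mulr1.
Qed.

HB.instance Definition _ := GRing.isZmodClosed.Build _ idele_pred idele_closed.

Record idele := Idele {
  idele_comp : prod_group (fun v : place F => unit_group (local_field v));
  idele_compP : idele_comp \in idele_pred
}.
HB.instance Definition _ := [isSub for idele_comp].
HB.instance Definition _ := [Choice of idele by <:].
HB.instance Definition _ := [SubChoice_isSubZmodule of idele by <:].

Definition icomp (x : idele) (v : place F) : unit_group (local_field v) :=
  idele_comp x v.
Coercion icomp : idele >-> Funclass.

Definition principal : {pred idele} := fun x =>
  `[< exists2 a : F, a != 0 & forall v, uval (x v) = embed v a >].

Lemma principal_closed : zmod_closed principal.
Proof.
split=> [|x y /asboolP[a a0 xa] /asboolP[b b0 yb]]; apply/asboolP.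
  by exists 1; rewrite ?oner_eq0 // => v; rewrite rmorph1.
exists (a / b); first by rewrite mulf_neq0 ?invr_eq0.
by move=> v; rewrite rmorphM fmorphV -xa -yb.
Qed.

HB.instance Definition _ := GRing.isZmodClosed.Build _ principal principal_closed.

Definition idele_class : Type := {ideal_quot principal}.
HB.instance Definition _ := GRing.Zmodule.on idele_class.

Definition to_class : idele -> idele_class := \pi_{ideal_quot principal}.

Lemma local_idele_subproof (v : place F) (a : unit_group (local_field v)) :
  dfwith (0 : prod_group (fun v : place F => unit_group (local_field v))) v a
    \in idele_pred.
Proof.
apply/asboolP; apply: (@sub_finite_set _ _ [set w | Fin w = v]).
  move=> w /=; apply: contra_notP => /eqP; rewrite eq_sym => vw.
  by rewrite dfwithout // /labs cabs1.
case: v a => [v|v] _.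
  rewrite (_ : [set _ | _] = [set v]); first exact: finite_set1.
  by apply/seteqP; split=> w /= => [[]|->].
by rewrite (_ : [set _ | _] = set0) //; apply/seteqP; split=> w.
Qed.

(* the idele with component a at v and 1 elsewhere *)
Definition local_idele (v : place F) (a : unit_group (local_field v)) : idele :=
  Idele (local_idele_subproof a).

(* continuity for the restricted product topology, into a discrete space *)
Definition idele_continuous (T : Type) (f : idele -> T) : Prop :=
  forall x : idele, exists P : set (place F), exists eps : R,
  [/\ finite_set P, forall w, P (Arch w), 0 < eps &
    forall y : idele,
      (forall v, P v -> labs (uval (y v) - uval (x v)) < eps) ->
      (forall v : fplace F, ~ P (Fin v) ->
         labs (uval (y (Fin v)) / uval (x (Fin v))) = 1) ->
    f y = f x].

End Ideles.

Section Norms.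

Definition field_norm (E E' : fieldType) (j : {rmorphism E -> E'})
    (y : E') (n : E) : Prop :=
  exists d (b : 'I_d -> E') (M : 'M[E]_d),
  [/\ forall z, exists! c : 'rV[E]_d, z = \sum_i j (c 0 i) * b i,
      forall i, y * b i = \sum_l j (M i l) * b l
    & n = \det M].

Context (K : fieldType) (L : fieldExtType K).

Definition above (w : place L) (v : place K) : Prop :=
  forall a : K, place_abs v a < 1 <-> place_abs w a%:A < 1.

Definition local_embedding (w : place L) (v : place K)
    (j : {rmorphism local_field v -> local_field w}) : Prop :=
  (forall a : K, j (embed v a) = embed w a%:A) /\
  (forall eps : R, 0 < eps -> exists2 delta : R, 0 < delta &
     forall x, labs x < delta -> labs (j x) < eps).

Definition local_norm (w : place L) (v : place K) (y : local_field w)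
    (n : local_field v) : Prop :=
  exists2 j, @local_embedding w v j & field_norm j y n.

(* x is the norm of the idele y of L *)
Definition idele_norm (y : idele L) (x : forall v : place K, local_field v) :
    Prop :=
  forall v : place K, exists2 n : place L -> local_field v,
    (forall w, above w v -> local_norm (uval (y w)) (n w)) &
    x v = \big[*%R/1]_(w \in [set w | above w v]) n w.

End Norms.

(* L is the abelian extension of K attached to psi by class field theory: the
   kernel of psi is the image of the norm group of L in the idele classes. *)
Definition class_field_of (K : fieldType) (G : zmodType)
    (psi : idele_class K -> G) (L : splittingFieldType K) : Prop :=
  [/\ galois 1 {:L}, abelian 'Gal({:L} / 1) &
    forall x : idele K, psi (to_class x) = 0 <->
      exists2 a : K, a != 0 &
      exists y : idele L, idele_norm y (fun v => embed v a * uval (x v))].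

(* the unit of O_v with value x, when x is one, and the unit 1 otherwise *)
Definition to_vunit F (v : fplace F) (x : local_field (Fin v)) :
    unit_group (vring v) :=
  insubd (0 : unit_group (vring v)) (insubd (0 : vring v) x).

Definition in_vunits F (v : fplace F) (x : unit_group (local_field (Fin v))) :
    Prop :=
  exists y : unit_group (vring v), uval x = vr_val (uval y).

Definition integral_at F (v : fplace F) (x : F) : Prop :=
  embed (Fin v) x \in @vring_pred F v.

Definition unit_at F (v : fplace F) (x : F) : Prop :=
  [/\ x != 0, integral_at v x & integral_at v x^-1].

(* the class of x in the units of the residue field, for x with unit_at v x *)
Definition unit_residue F (v : fplace F) (x : F) : unit_group (residue v) :=
  unit_map (@to_residue F v) (to_vunit (embed (Fin v) x)).

(* A is a subring of a field here, hence a domain *)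
Definition is_pid (F : fieldType) (A : set F) : Prop :=
  forall I : set F, I `<=` A -> I 0 ->
    (forall x y, I x -> I y -> I (x + y)) ->
    (forall a x, A a -> I x -> I (a * x)) ->
  exists2 g, A g & I = [set g * a | a in A].

Definition generates (F : fieldType) (I : finType) (g : I -> F) (U : set F) :
    Prop :=
  (forall i, U (g i)) /\
  (forall x, U x -> exists n : I -> int, x = \prod_i g i ^ n i).

Section SObjects.
Context {F : fieldType} (S : set (place F)).

(* the finite places not in S; these are all the places not in S as soon as S
   contains the archimedean places *)
Record outside := Outside { oval :> fplace F; ovalP : Fin oval \notin S }.
HB.instance Definition _ := [isSub for oval].
HB.instance Definition _ := [Choice of outside by <:].

Definition S_integers : set F := [set x | forall v : outside, integral_at v x].

Definition S_units : set F :=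
  [set x | [/\ x != 0, S_integers x & S_integers x^-1]].

Definition unramified_outside (G : zmodType) (psi : idele_class F -> G) : Prop :=
  forall (v : outside) (a : unit_group (local_field (Fin v))), in_vunits a ->
    psi (to_class (local_idele a)) = 0.

Definition spl (G : zmodType) (psi : idele_class F -> G) : set outside :=
  [set v | forall a : unit_group (local_field (Fin v)),
             psi (to_class (local_idele a)) = 0].

(* T(S;e;1;X) *)
Definition T_one (e : nat) (X : set F) : set outside :=
  [set v | (residue_card v = 1 %[mod e])%N /\
     forall x, X x -> unit_at v x /\
       exists z : unit_group (residue v), unit_residue v x = z *+ e].

(* T(S;e;psi;X) *)
Definition T_spl (e : nat) (G : zmodType) (psi : idele_class F -> G)
    (X : set F) : set outside :=
  spl psi `&` T_one e X.

(* T(S;e;X;y) *)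
Definition T_irr (e : nat) (X : set F) (y : F) : set outside :=
  [set w | [/\ T_one e X w, unit_at w y &
     irreducible_poly ('X^e - (uval (unit_residue w y))%:P)]].

Definition ohat : Type := prod_group (fun v : outside => unit_group (vring v)).
HB.instance Definition _ := GRing.Zmodule.on ohat.

(* continuity for the product topology, into a discrete space *)
Definition ohat_continuous (T : Type) (f : ohat -> T) : Prop :=
  forall x : ohat, exists P : set outside, exists eps : R,
  [/\ finite_set P, 0 < eps &
    forall y : ohat,
      (forall v, P v -> labs (vr_val (uval (y v)) - vr_val (uval (x v))) < eps) ->
    f y = f x].

Definition S_ideles : set (idele F) :=
  [set x : idele F | forall v : outside, in_vunits (x (Fin v))].

(* the projection p, meaningful on S_ideles only *)
Definition S_proj (x : idele F) : ohat := fun v => to_vunit (uval (x (Fin v))).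

Definition characteristic_morphism (H : zmodType) (rho : ohat -> H) : Prop :=
  [/\ finite_set [set: H], zmod_morphism rho, ohat_continuous rho,
      forall h, exists x, rho x = h &
      forall (a : F) (x : ohat), S_units a ->
        (forall v : outside, vr_val (uval (x v)) = embed (Fin v) a) -> rho x = 0].

Definition induced_by (H : zmodType) (rhoS : ohat -> H)
    (rho : idele_class F -> H) : Prop :=
  forall x, S_ideles x -> rho (to_class x) = rhoS (S_proj x).

(* iota(pi) for a uniformiser pi at v which is a unit at the other places *)
Definition iota_hat (v : outside) (pi : F) : ohat :=
  fun w => if w == v then 0 else to_vunit (embed (Fin w) pi^-1).

Definition residue_tensor (I : Type) (x : I -> outside) (e : nat) : zmodType :=
  tensorZ (prod_group (fun i => unit_group (residue (x i)))) e.

Definition reduce (I : Type) (x : I -> outside) (e : nat) (y : ohat) :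
    residue_tensor x e :=
  @to_tensorZ (prod_group (fun i => unit_group (residue (x i)))) e
    (fun i => unit_map (@to_residue F (x i)) (y (x i))).

End SObjects.

(* Main.v *)
(** The classes modulo [e] of primitive roots of the residue fields at the [v_i]
    and [w_i] form a basis of [G'].  The image under [rho'] of the units of
    [K_{v_i}] is generated by the class [e_i] of a primitive root at [v_i] and by
    the image [e_i'] of [iota(pi_i)], because [pi_i] at [v_i] differs from
    [iota(pi_i)] by the principal idele [pi_i].  By the choice of the [c_l], the
    element [e_j' - sum_{l < j} c_l e_l'] vanishes at [w_1], ..., [w_{j-1}], and
    at [w_j] it is the inverse of [u_j pi_j], which generates the units of the
    residue field modulo [e]-th powers since [X^e - u_j pi_j] is irreducible.  So
    the [e_i] and [e_i'] span [G'] by triangularity, and they form a basis because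
    [G'] has exactly [e^(2k')] elements. *)

From HB Require Import structures.
Require Import Defs.
From mathcomp Require Import all_boot all_order all_algebra all_fingroup all_field.
From mathcomp Require Import cyclic generic_quotient finmap.
From mathcomp Require Import all_classical reals topology normedtype.
From mathcomp Require Import lra.

Set Implicit Arguments.
Unset Strict Implicit.
Unset Printing Implicit Defensive.

Import Order.TTheory GRing.Theory Num.Theory.
Import numFieldNormedType.Exports.
Local Open Scope quotient_scope.
Local Open Scope ring_scope.
Local Open Scope classical_set_scope.

(** * Generators and bases modulo [e] *)

(** The class of [y] generates [A/eA]. For [e > 0] natural multiples suffice, since [- y] agrees
    with [y *+ e.-1] modulo [e]. *)
Definition spans_mod (A : zmodType) (e : nat) (y : A) : Prop :=
  forall z, exists n t, z = y *+ n + t *+ e.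

(** For [e > 0], the class of [y] has order exactly [e] in [A/eA]; with [spans_mod], it is a basis
    of [A/eA]. *)
Definition free_mod (A : zmodType) (e : nat) (y : A) : Prop :=
  forall n t, y *+ n = t *+ e -> (e %| n)%N.

Lemma spans_modN (A : zmodType) e (y : A) : spans_mod e (- y) -> spans_mod e y.
Proof.
move=> ys z; have [n [t ht]] := ys (- z).
by exists n, (- t); rewrite -[z]opprK ht opprD mulNrn opprK mulNrn.
Qed.

Section Spanned.
Context (B : zmodType) (J : finType) (b : J -> B).

(** Integer coefficients make this a subgroup, so that membership follows from closure properties;
    [spanned_mod] bounds the coefficients afterwards. *)
Definition spanned : {pred B} :=
  fun x => `[< exists n : J -> int, x = \sum_j b j *~ n j >].

Lemma spanned_closed : zmod_closed spanned.
Proof.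
split=> [|x y /asboolP[m ->] /asboolP[n ->]]; apply/asboolP.
  by exists (fun=> 0); rewrite big1.
exists (fun j => m j - n j); rewrite -sumrB.
by apply: eq_bigr => j _; rewrite mulrzBr.
Qed.

HB.instance Definition _ := GRing.isZmodClosed.Build B spanned spanned_closed.

Lemma spanned_gen j : b j \in spanned.
Proof.
apply/asboolP; exists (fun i => (i == j)%:Z).
by rewrite (bigD1 j) //= eqxx mulr1z big1 ?addr0 // => i /negPf->.
Qed.

Lemma spanned_mod (e : nat) (x : B) : (0 < e)%N -> (forall j, b j *+ e = 0) ->
  x \in spanned -> exists c : {ffun J -> 'I_e}, x = \sum_j b j *+ c j.
Proof.
move=> e0 be /asboolP[n ->].
have ne0 : e%:Z != 0 by rewrite eqz_nat -lt0n.
have lt j : (`|(n j %% e)%Z| < e)%N.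
  by rewrite -ltz_nat gez0_abs ?modz_ge0 // ltz_pmod.
exists [ffun j => Ordinal (lt j)]; apply: eq_bigr => j _.
rewrite ffunE /= {1}(divz_eq (n j) e) mulrzDr mulrC mulrzA [b j *~ e]be.
by rewrite mul0rz add0r -[in LHS](gez0_abs (modz_ge0 (n j) ne0)).
Qed.

End Spanned.

(** Both families have the same finite set of coefficient vectors. Rewriting [b']-coordinates in the
    basis [b] maps this set onto itself, hence injectively. *)
Lemma spanning_basis_mod (A : zmodType) (e : nat) (I : finType) (b b' : I -> A) :
  basis_mod e [set: A] b ->
  (forall x, exists c : {ffun I -> 'I_e}, x = \sum_i b' i *+ c i) ->
  basis_mod e [set: A] b'.
Proof.
move=> [_ bb] bs; split=> // x _.
have /choice[f hf] (c : {ffun I -> 'I_e}) : exists d : {ffun I -> 'I_e},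
    \sum_i b' i *+ c i = \sum_i b i *+ d i.
  by have [//|d [hd _]] := bb (\sum_i b' i *+ c i); exists d.
have /choice[h hh] (d : {ffun I -> 'I_e}) : exists c, f c = d.
  have [c hc] := bs (\sum_i b i *+ d i); exists c.
  have [//|d' [_ hd']] := bb (\sum_i b i *+ d i).
  by rewrite -(hd' _ erefl) -[LHS](hd' (f c)) // hc hf.
(* The section [h] of [f] is an injective self-map of a finite set, hence bijective, and so is
   [f]. *)
have hi : injective h by apply: can_inj hh.
have finj : injective f.
  by apply: bij_inj; apply: (bij_can_bij (injF_bij hi) hh).
have [c hc] := bs x; exists c; split=> // c' hc'; apply: finj.
have [//|d [_ hd]] := bb x.
by rewrite -[LHS]hd -?[RHS]hd // ?hc -?hf // hf -hc' hc.
Qed.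

(** * Tensor products of finite products with Z/eZ *)

Section TensorMod.
Context (A : zmodType) (e : nat).

Lemma to_tensorZ_zmod : zmod_morphism (@to_tensorZ A e).
Proof. by move=> x y; rewrite /to_tensorZ raddfB. Qed.

HB.instance Definition _ :=
  GRing.isZmodMorphism.Build A (tensorZ A e) (@to_tensorZ A e) to_tensorZ_zmod.

Lemma to_tensorZ_eq0 (x : A) : to_tensorZ e x = 0 <-> exists y, x = y *+ e.
Proof.
have -> : (to_tensorZ e x = 0) <-> (x \in @multiples A e).
  have -> : (0 : tensorZ A e) = to_tensorZ e 0 by rewrite raddf0.
  rewrite -[x in x \in _]subr0 Quotient.idealrBE.
  by split=> [h|/eqP//]; apply/eqP.
by split=> [/asboolP|?]; last exact/asboolP.
Qed.

Lemma to_tensorZ_surj (z : tensorZ A e) : exists x, z = to_tensorZ e x.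
Proof. by exists (repr z); rewrite /to_tensorZ reprK. Qed.

Lemma tensorZ_mulrn (z : tensorZ A e) : z *+ e = 0.
Proof.
have [x ->] := to_tensorZ_surj z; rewrite -raddfMn.
by apply/to_tensorZ_eq0; exists x.
Qed.

End TensorMod.

Section ProdTensor.
Context (I : finType) (A : I -> zmodType) (e : nat).
Local Notation P := (prod_group A).

Definition pg_inj i (x : A i) : P := dfwith (0 : P) i x.

Lemma pg_sumE (J : Type) (s : seq J) (Q : pred J) (F : J -> P) i :
  (\sum_(j <- s | Q j) F j) i = \sum_(j <- s | Q j) F j i.
Proof. exact: (big_morph (fun p : P => p i)). Qed.

Lemma pg_mulrnE (p : P) n i : (p *+ n) i = p i *+ n.
Proof. by elim: n => [//|n IH]; rewrite !mulrS -IH. Qed.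

Lemma pg_inj_zmod i : zmod_morphism (@pg_inj i).
Proof.
move=> x y; apply: functional_extensionality_dep => j.
rewrite -[RHS]/(pg_inj x j - pg_inj y j) /pg_inj.
have [<-|ij] := eqVneq i j; first by rewrite !dfwithin.
by rewrite !dfwithout // subr0.
Qed.

HB.instance Definition _ i :=
  GRing.isZmodMorphism.Build (A i) P (@pg_inj i) (@pg_inj_zmod i).

Lemma pg_decomp (p : P) : p = \sum_i pg_inj (p i).
Proof.
apply: functional_extensionality_dep => i.
rewrite pg_sumE (bigD1 i) //= big1 ?addr0 => [|j ji]; rewrite /pg_inj.
  by rewrite dfwithin.
by rewrite dfwithout.
Qed.

Definition tensor_inj i (x : A i) : tensorZ P e := to_tensorZ e (pg_inj x).

Lemma tensor_inj_zmod i : zmod_morphism (@tensor_inj i).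
Proof. by move=> x y; rewrite /tensor_inj !raddfB. Qed.

HB.instance Definition _ i :=
  GRing.isZmodMorphism.Build (A i) (tensorZ P e) (@tensor_inj i)
    (@tensor_inj_zmod i).

Lemma tensor_decomp (p : P) : to_tensorZ e p = \sum_i tensor_inj (p i).
Proof. by rewrite {1}[p]pg_decomp raddf_sum. Qed.

Lemma tensor_inj_multiple i (t : A i) : tensor_inj (t *+ e) = 0.
Proof. by rewrite raddfMn /= tensorZ_mulrn. Qed.

Lemma tensor_inj_spans i (y : A i) : spans_mod e y ->
  forall z : A i, exists n, tensor_inj z = tensor_inj y *+ n.
Proof.
move=> ys z; have [n [t ->]] := ys z; exists n.
by rewrite raddfD /= tensor_inj_multiple addr0 raddfMn.
Qed.

Context (e_gt0 : (0 < e)%N).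

(** Spanning is checked factor by factor. For uniqueness, equality in the tensor product means that
    the components of the two lifts differ by multiples of [e], and freeness in each factor
    applies. *)
Lemma tensor_basis (g : forall i, A i) :
  (forall i, spans_mod e (g i)) -> (forall i, free_mod e (g i)) ->
  basis_mod e [set: tensorZ P e] (fun i => tensor_inj (g i)).
Proof.
move=> gs gf; split=> // x _.
have [p ->] := to_tensorZ_surj x.
have [||c xc] := @spanned_mod _ _ (fun i => tensor_inj (g i)) _
    (to_tensorZ e p) e_gt0.
- by move=> i; rewrite tensorZ_mulrn.
- rewrite tensor_decomp; apply: rpred_sum => i _.
  have [n ->] := tensor_inj_spans (gs i) (p i).
  exact/rpredMn/(spanned_gen (fun i => tensor_inj (g i))).
exists c; split=> // c'; rewrite {}xc => /eqP.
pose G (d : {ffun I -> 'I_e}) : P := fun i => g i *+ d i.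
have GE (d : {ffun I -> 'I_e}) :
    \sum_i tensor_inj (g i) *+ d i = to_tensorZ e (G d).
  by rewrite tensor_decomp; apply: eq_bigr => i _; rewrite raddfMn.
rewrite !GE => /eqP cc'; apply/ffunP => i; apply/val_inj.
(* Subtraction of coefficients is truncated, so they are ordered first. *)
wlog le : c c' cc' / (c i <= c' i)%N.
  by move=> W; have [/W->//|/ltnW/W->] := leqP (c i) (c' i).
have /to_tensorZ_eq0[q /(congr1 (fun p : P => p i))] :
    to_tensorZ e (G c' - G c) = 0 by rewrite raddfB /= cc' subrr.
rewrite pg_mulrnE -[LHS]/(g i *+ c' i - g i *+ c i) -mulrnBr // => /gf.
(* The difference of the coefficients is below [e] and divisible by [e], hence zero. *)
have := leq_ltn_trans (leq_subr (c i) (c' i)) (ltn_ord (c' i)).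
rewrite [X in (X < _)%N -> _]/=; case: (posnP (c' i - c i)%N) => [/eqP h _ _|h1 h2].
  by apply/eqP; rewrite eqn_leq le.
by rewrite gtnNdvd.
Qed.

End ProdTensor.

(** Coefficients on the fibre over [i], extended by zero, are coefficients for all of [b], so
    uniqueness is inherited. *)
Lemma basis_mod_fiber (B : zmodType) (e : nat) (I J : finType) (b : I * J -> B)
    (M : set B) (i : I) : (0 < e)%N ->
  basis_mod e [set: B] b -> (forall j, M (b (i, j))) ->
  (forall x, M x -> exists c : {ffun J -> 'I_e}, x = \sum_j b (i, j) *+ c j) ->
  basis_mod e M (fun j => b (i, j)).
Proof.
move=> e0 [_ bb] Mb Ms; split=> // x /Ms[c xc]; exists c; split=> // c' xc'.
pose ext (d : {ffun J -> 'I_e}) : {ffun I * J -> 'I_e} :=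
  [ffun a => if a.1 == i then d a.2 else Ordinal e0].
have extE (d : {ffun J -> 'I_e}) : \sum_j b (i, j) *+ d j = \sum_a b a *+ ext d a.
  rewrite [RHS](eq_bigr (fun a => b (a.1, a.2) *+ ext d (a.1, a.2))); last by case.
  rewrite -(pair_bigA _ (fun i' j => b (i', j) *+ ext d (i', j))) /=.
  rewrite (bigD1 i) //= [X in _ + X]big1 ?addr0 => [|i' /negPf i'i].
    by apply: eq_bigr => j _; rewrite ffunE eqxx.
  by apply: big1 => j _; rewrite ffunE /= i'i.
have [//|d [_ hd]] := bb x.
have : ext c = ext c' by rewrite -[LHS]hd -?[RHS]hd // -extE.
by move=> /ffunP cc'; apply/ffunP => j; have := cc' (i, j); rewrite !ffunE eqxx.
Qed.

(* Descending induction on [j]: the [(j, true)]-component of [p j] is the only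
   one that is not yet known to lie in the subgroup [M]. *)
Lemma triangular_span (k e : nat) (A : 'I_k * bool -> zmodType)
    (M : zmodClosed (tensorZ (prod_group A) e)) :
  (forall i (z : A (i, false)), tensor_inj e z \in M) ->
  (forall j : 'I_k, exists p : prod_group A, [/\ to_tensorZ e p \in M,
     forall l : 'I_k, (l < j)%N -> exists t, p (l, true) = t *+ e &
     spans_mod e (p (j, true))]) ->
  forall x, x \in M.
Proof.
move=> Mf Mt x; have [q ->] := to_tensorZ_surj x.
suff Mi j (z : A (j, true)) : tensor_inj e z \in M.
  by rewrite tensor_decomp; apply: rpred_sum => -[j []] _; [exact: Mi|exact: Mf].
have [m] := ubnP (k - j); elim: m => // m IH in j z *; rewrite ltnS => jm.
have [p [pM pl ps]] := Mt j.
have [n ->] := tensor_inj_spans ps z; apply: rpredMn.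
rewrite tensor_decomp (bigD1 (j, true)) //= in pM.
rewrite rpredDr // in pM; apply: rpred_sum => -[l []] lj; last exact: Mf.
have [lt|gt|/val_inj eq] := ltngtP l j.
- by have [t ->] := pl _ lt; rewrite tensor_inj_multiple rpred0.
- by apply: IH; apply: leq_trans jm; apply: ltn_sub2l.
- by rewrite eq eqxx in lj.
Qed.

(** * Cyclicity of finite residue fields *)

Lemma spans_mod1 (A : zmodType) (y : A) : spans_mod 1 y.
Proof. by move=> z; exists 0%N, z; rewrite add0r. Qed.

(** Multiplication by a nonzero [x] permutes the nonzero elements; comparing products shows that
    each of them is a root of unity of order dividing [(size s).-1]. There are that many of them,
    which forces a primitive root. *)
Lemma finite_field_prim_root (F : fieldType) (s : seq F) :
  uniq s -> (forall x, x \in s) -> 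
  exists2 g : F, (size s).-1.-primitive_root g &
    forall x : F, x != 0 -> x ^+ (size s).-1 = 1.
Proof.
move=> us sT; pose r := rem 0 s.
have ur : uniq r by rewrite rem_uniq.
have rE x : (x \in r) = (x != 0) by rewrite mem_rem_uniq // !inE sT andbT.
have sr : size r = (size s).-1 by rewrite size_rem.
have r1 : 1 \in r by rewrite rE oner_eq0.
have fermat x : x \in r -> x ^+ size r = 1.
  rewrite rE => x0.
  have xr : perm_eq [seq x * y | y <- r] r.
    apply: uniq_perm => //; first by rewrite map_inj_uniq //; exact: mulfI.
    move=> y; apply/mapP/idP => [[z]|]; rewrite !rE.
      by move=> z0 ->; rewrite mulf_neq0.
    move=> y0; exists (x^-1 * y); first by rewrite rE mulf_neq0 ?invr_eq0.
    by rewrite mulVKf.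
  have r0 : \prod_(y <- r) y != 0.
    by rewrite prodf_seq_neq0; apply/allP => y; rewrite rE.
  apply: (mulIf r0); rewrite mul1r -[in RHS](perm_big _ xr) /=.
  by rewrite big_map big_split /= big_const_seq count_predT iter_mulr_1.
have r0 : (0 < size r)%N by case: (r) r1.
have rr : all (size r).-unity_root r.
  by apply/allP => x xr; apply/unity_rootP; exact: fermat.
have /hasP[g _ pg] := has_prim_root r0 rr ur (leqnn _).
by rewrite -sr; exists g => // x x0; rewrite fermat ?rE.
Qed.

(** For [n = 0] the polynomial is constant. *)
Lemma irreducible_XnsubC_gt0 (F : fieldType) (n : nat) (a : F) :
  irreducible_poly ('X^n - a%:P) -> (0 < n)%N.
Proof.
case: n => // -[sz _]; move: sz.
by rewrite expr0 -[1]/(1%:P) -polyCB ltnNge size_polyC_leq1.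
Qed.

Section UnitGroups.
Context (F : fieldType).

Lemma uval_mulrn (x : unit_group F) n : uval (x *+ n) = uval x ^+ n.
Proof. by elim: n => [//|n IH]; rewrite mulrS exprS -IH. Qed.

Lemma uval_mulrz (x : unit_group F) (m : int) : uval (x *~ m) = uval x ^ m.
Proof.
case: m => n; first exact: uval_mulrn.
by rewrite NegzE mulrNz -exprnN -[LHS]/((uval (x *+ n.+1))^-1) uval_mulrn.
Qed.

Lemma uval_neq0 (x : unit_group F) : uval x != 0.
Proof. by rewrite -unitfE uvalP. Qed.

(** For [e > 1] the field is finite and [e] divides the order of its cyclic unit group, so a
    primitive root has order [e] modulo [e]-th powers. *)
Lemma unit_group_cyclic_mod (e : nat) : (0 < e)%N ->
    (#|` fset_set [set: F]|%fset = 1 %[mod e])%N ->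
  exists2 g : unit_group F, spans_mod e g & free_mod e g.
Proof.
move=> e0; have [->|e1] := eqVneq e 1%N.
  move=> _; exists 0 => [|n t _]; [exact: spans_mod1|exact: dvd1n].
(* For infinite [F] the default value of [fset_set] is empty, and 0 is not 1 modulo [e] as
   [e > 1]. *)
move=> qe; have fin : finite_set [set: F].
  apply: contrapT => inf; move: qe; rewrite /fset_set; case: pselect => // _.
  rewrite cardfs0 mod0n modn_small; first by [].
  by rewrite ltn_neqAle eq_sym e1.
pose s : seq F := fset_set [set: F].
have sT x : x \in s by rewrite in_fset_set // inE.
have [|//|g pg fermat] := @finite_field_prim_root F s; first exact: fset_uniq.
have s0 : (0 < size s)%N by case: (s) (sT 0).
have es : (e %| (size s).-1)%N.
  by rewrite -subn1 -eqn_mod_dvd //; apply/eqP.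
have gu : g \is a GRing.unit.
  rewrite unitfE; apply/eqP => g0; have := prim_expr_order pg.
  rewrite g0 expr0n eqn0Ngt (prim_order_gt0 pg) => /eqP.
  by rewrite eq_sym oner_eq0.
have gen (z : unit_group F) : exists n, z = UnitGroup gu *+ n.
  have [i zi] := prim_rootP pg (fermat _ (uval_neq0 z)).
  by exists i; apply/val_inj; rewrite /= uval_mulrn.
exists (UnitGroup gu) => [z|n t].
  by have [n ->] := gen z; exists n, 0; rewrite mul0rn addr0.
(* With [t] the [m]-th power of the root, [n] and [m * e] agree modulo [(size s).-1], hence modulo
   its divisor [e]. *)
have [m ->] := gen t; rewrite -mulrnA => /(congr1 (@uval F))/eqP.
rewrite !uval_mulrn (eq_prim_root_expr pg) => /eqP nm.
by rewrite /dvdn -(modn_dvdm n es) nm (modn_dvdm _ es) modnMl.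
Qed.

(** Write [y] as [g *+ m + t *+ e] and let [d] be the gcd of [m] and [e]. Then [y] is the [d]-th
    power of some [a], and ['X^(e %/ d) - a] divides ['X^e - y]. Irreducibility forces [d = 1], so
    [m] is invertible modulo [e]. *)
Lemma irreducible_spans_mod (e : nat) (g y : unit_group F) :
  spans_mod e g -> irreducible_poly ('X^e - (uval y)%:P) -> spans_mod e y.
Proof.
move=> gs yirr; have e0 := irreducible_XnsubC_gt0 yirr; have [_ irr] := yirr.
have [m [t yE]] := gs y.
have co : gcdn m e = 1%N.
  set d := gcdn m e; have d0 : (0 < d)%N by rewrite gcdn_gt0 e0 orbT.
  have dm : (d %| m)%N := dvdn_gcdl m e; have de : (d %| e)%N := dvdn_gcdr m e.
  pose a := g *+ (m %/ d) + t *+ (e %/ d).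
  have ya : y = a *+ d by rewrite mulrnDl -!mulrnA !divnK.
  have ed0 : (0 < e %/ d)%N by rewrite divn_gt0 // dvdn_leq.
  have sa : size ('X^(e %/ d) - (uval a)%:P) = (e %/ d).+1 by rewrite size_XnsubC.
  have : 'X^(e %/ d) - (uval a)%:P %= 'X^e - (uval y)%:P.
    apply: irr; first by rewrite sa eqSS -lt0n.
    rewrite ya uval_mulrn -[in 'X^e](divnK de) exprM rmorphXn subrXX.
    exact: dvdp_mulr.
  move/eqp_size; rewrite sa size_XnsubC // => -[] /eqP.
  by rewrite -{2}(divnK de) -{1}[(e %/ d)%N]muln1 eqn_pmul2l // => /eqP.
have [m0|m0] := posnP m.
  by move: co; rewrite m0 gcd0n => ->; exact: spans_mod1.
(* By the Bezout relation [p * m = q * e + 1], [y *+ p] is [g] modulo [e]. *)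
have [p q pq _] := egcdnP e m0; rewrite co in pq.
move=> z; have [n [t' zE]] := gs z; pose x := g *+ (q * n) + t *+ (p * n).
have yx : y *+ (p * n) = g *+ n + x *+ e.
  rewrite yE !mulrnDl -!mulrnA.
  have -> : (m * (p * n) = n + q * n * e)%N.
    by rewrite mulnA (mulnC m) pq mulnDl mul1n addnC mulnAC.
  by rewrite mulrnDr -addrA (mulnC e).
by exists (p * n)%N, (t' - x); rewrite mulrnBl yx zE -addrA [x *+ e + _]addrC subrK.
Qed.

End UnitGroups.

(** * Local fields *)

Lemma unit_map_zmod (A B : comUnitRingType) (f : {rmorphism A -> B}) :
  zmod_morphism (unit_map f).
Proof.
move=> x y; apply: val_inj => /=.
by rewrite rmorphM rmorphV ?uvalP.
Qed.

HB.instance Definition _ (A B : comUnitRingType) (f : {rmorphism A -> B}) :=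
  GRing.isZmodMorphism.Build (unit_group A) (unit_group B) (unit_map f)
    (unit_map_zmod f).

Lemma completion_dense (F : fieldType) (v : absval F) (x : completion v) (eps : R) :
  0 < eps -> exists a, cabs (x - cembed v a) < eps.
Proof.
move=> eps0; rewrite -[x]reprK; set u : cauchy_seq v := repr x.
(* Strict bounds become weak in the limit, hence the margin. *)
have e2 : 0 < eps / 2 by lra.
have /asboolP /(_ _ e2) [N hN] := cseqP u.
exists (u N); pose c := CauchySeq (const_cauchy v (u N)).
have -> : \pi_{ideal_quot (null_pred v)} u - cembed v (u N) =
    \pi_{ideal_quot (null_pred v)} (u - c).
  exact: esym (@raddfB _ _ \pi_{ideal_quot (null_pred v)} u c).
apply: (@le_lt_trans _ _ (eps / 2)); last by lra.
apply: (ler_cvg_to (@cabs_cvg _ _ (u - c)) (cvg_cst (eps / 2))).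
by exists N => // n /= Nn; rewrite ltW // hN.
Qed.

Lemma uvalD (A : comUnitRingType) (x y : unit_group A) :
  uval (x + y) = uval x * uval y.
Proof. by []. Qed.

Section Local.
Context (F : fieldType) (v : fplace F).
Local Notation Fv := (local_field (Fin v)).

Lemma labs_gt0 (x : Fv) : x != 0 -> 0 < labs x.
Proof.
move=> x0; rewrite lt_def cabs_ge0 andbT.
by apply: contra_eq_neq (cabsV x0) => x1; rewrite [cabs x]x1 mulr0 eq_sym oner_eq0.
Qed.

Lemma labsV (x : Fv) : x != 0 -> labs x^-1 = (labs x)^-1.
Proof.
move=> x0; apply: (mulIf (lt0r_neq0 (labs_gt0 x0))).
by rewrite mulVf ?lt0r_neq0 ?labs_gt0 //; exact: cabsV.
Qed.

Lemma labs_neq0 (x : Fv) : labs x = 1 -> x != 0.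
Proof. by apply: contra_eq_neq => ->; rewrite /labs cabs0 eq_sym oner_eq0. Qed.

Lemma vring_predE (x : Fv) : (x \in @vring_pred F v) = (labs x <= 1).
Proof. by []. Qed.

Lemma vr_valM (x y : vring v) : vr_val (x * y) = vr_val x * vr_val y.
Proof. by []. Qed.

Lemma vunit_inj (y z : unit_group (vring v)) :
  vr_val (uval y) = vr_val (uval z) -> y = z.
Proof. by move=> yz; do 2!apply: val_inj. Qed.

Lemma to_vunitK (y : unit_group (vring v)) : to_vunit (vr_val (uval y)) = y.
Proof. by rewrite /to_vunit !valKd. Qed.

(** Both [y] and its inverse have absolute value at most 1. *)
Lemma vunit_labs (y : unit_group (vring v)) : labs (vr_val (uval y)) = 1.
Proof.
set x := vr_val (uval y); have x1 : labs x <= 1 := vr_valP (uval y).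
have z1 : labs (vr_val (uval (- y))) <= 1 := vr_valP _.
have xz : x * vr_val (uval (- y)) = 1.
  by rewrite -vr_valM -uvalD subrr.
have := @cabsM _ _ x (vr_val (uval (- y))); rewrite xz cabs1 => h.
apply/eqP; rewrite eq_le x1 /= h ler_piMr //; exact: cabs_ge0.
Qed.

Lemma labs1_vunit (x : Fv) : labs x = 1 ->
  exists y : unit_group (vring v), vr_val (uval y) = x.
Proof.
move=> x1; have xi : x \in @vring_pred F v by rewrite vring_predE x1.
have yi : x^-1 \in @vring_pred F v.
  by rewrite vring_predE labsV ?labs_neq0 // x1 invr1.
have xu : VRing xi \is a GRing.unit.
  apply: (@vring_unitPl _ _ _ (VRing yi)); apply: val_inj => /=.
  by rewrite mulVf ?labs_neq0.
by exists (UnitGroup xu).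
Qed.

Lemma to_vunitE (x : Fv) : labs x = 1 -> vr_val (uval (to_vunit x)) = x.
Proof. by move=> /labs1_vunit[y <-]; rewrite to_vunitK. Qed.

Lemma to_vunitM (x y : Fv) : labs x = 1 -> labs y = 1 ->
  to_vunit (x * y) = to_vunit x + to_vunit y.
Proof.
move=> x1 y1; apply: vunit_inj; rewrite to_vunitE; last first.
  by rewrite /labs cabsM [cabs x]x1 [cabs y]y1 mulr1.
by rewrite uvalD vr_valM !to_vunitE.
Qed.

Lemma to_vunit1 : to_vunit (1 : Fv) = 0.
Proof. exact: (to_vunitK 0). Qed.

Lemma to_vunitV (x : Fv) : labs x = 1 -> to_vunit x^-1 = - to_vunit x.
Proof.
move=> x1; have x0 := labs_neq0 x1.
apply/eqP; rewrite -addr_eq0 -to_vunitM ?labsV ?x1 ?invr1 // mulVf //.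
by rewrite to_vunit1.
Qed.

Lemma unit_atP (x : F) : unit_at v x <-> x != 0 /\ labs (embed (Fin v) x) = 1.
Proof.
rewrite /unit_at /integral_at !vring_predE fmorphV.
split=> [[x0]|[x0 x1]].
  have ex0 : embed (Fin v) x != 0 by rewrite fmorph_eq0.
  rewrite labsV // => x1 x2; split=> //; apply/eqP; rewrite eq_le x1 /=.
  by rewrite -invf_le1 ?labs_gt0.
by rewrite labsV ?fmorph_eq0 // x1 invr1.
Qed.

Lemma unit_at1 : unit_at v 1.
Proof. by apply/unit_atP; rewrite oner_eq0 rmorph1 /labs cabs1. Qed.

Lemma unit_atM x y : unit_at v x -> unit_at v y -> unit_at v (x * y).
Proof.
move=> /unit_atP[x0 x1] /unit_atP[y0 y1]; apply/unit_atP.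
split; first by rewrite mulf_neq0.
by rewrite rmorphM /labs cabsM [cabs _]x1 [cabs _]y1 mulr1.
Qed.

Lemma unit_atV x : unit_at v x -> unit_at v x^-1.
Proof. by move=> [x0 x1 x2]; split; rewrite ?invr_eq0 ?invrK. Qed.

Lemma unit_residueE x (y : unit_group (vring v)) :
  vr_val (uval y) = embed (Fin v) x ->
  unit_map (@to_residue F v) y = unit_residue v x.
Proof. by rewrite /unit_residue => <-; rewrite to_vunitK. Qed.

Lemma unit_residue1 : unit_residue v 1 = 0.
Proof. by rewrite /unit_residue rmorph1 to_vunit1 raddf0. Qed.

Lemma unit_residueM x y : unit_at v x -> unit_at v y ->
  unit_residue v (x * y) = unit_residue v x + unit_residue v y.
Proof.
move=> /unit_atP[x0 x1] /unit_atP[y0 y1].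
by rewrite /unit_residue rmorphM to_vunitM // raddfD.
Qed.

Lemma unit_residueV x : unit_at v x -> unit_residue v x^-1 = - unit_residue v x.
Proof.
by move=> /unit_atP[x0 x1]; rewrite /unit_residue fmorphV to_vunitV // raddfN.
Qed.

Lemma unit_atX x n : unit_at v x -> unit_at v (x ^+ n).
Proof.
by move=> ux; elim: n => [|n IH]; [exact: unit_at1|rewrite exprS; exact: unit_atM].
Qed.

Lemma unit_residueX x n : unit_at v x ->
  unit_residue v (x ^+ n) = unit_residue v x *+ n.
Proof.
move=> ux; elim: n => [|n IH]; first exact: unit_residue1.
by rewrite exprS mulrS -IH unit_residueM //; exact: unit_atX.
Qed.

Lemma unit_residue_prod (I : finType) (P : pred I) (f : I -> F) :
  (forall i, P i -> unit_at v (f i)) ->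
  unit_at v (\prod_(i | P i) f i) /\
  unit_residue v (\prod_(i | P i) f i) = \sum_(i | P i) unit_residue v (f i).
Proof.
move=> fu; pose Q x s := unit_at v x /\ unit_residue v x = s.
apply: (big_ind2 Q) => [|x1 x2 y1 y2 [u1 <-] [u2 <-]|i Pi].
- by split; [exact: unit_at1|exact: unit_residue1].
- by split; [exact: unit_atM|exact: unit_residueM].
- by split; first exact: fu.
Qed.

(** A representative of a nonzero residue lies outside the maximal ideal, so its absolute value is
    1. *)
Lemma unit_residue_lift (z : unit_group (residue v)) :
  exists y : unit_group (vring v), unit_map (@to_residue F v) y = z.
Proof.
pose x : vring v := repr (uval z).
have zx : to_residue x = uval z by rewrite /to_residue reprK.
have x1 : labs (vr_val x) = 1.
  apply/eqP; rewrite eq_le (vr_valP x : labs _ <= 1) /= leNgt.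
  apply: contraNN (uval_neq0 z) => x1; rewrite -zx.
  have -> : (0 : residue v) = to_residue 0 by rewrite rmorph0.
  by rewrite /to_residue -Quotient.idealrBE subr0.
have [y yx] := labs1_vunit x1; exists y; apply: val_inj => /=.
by rewrite -zx; congr to_residue; exact: val_inj.
Qed.

Lemma unit_map_residue_eq (x y : unit_group (vring v)) :
  labs (vr_val (uval x) - vr_val (uval y)) < 1 ->
  unit_map (@to_residue F v) x = unit_map (@to_residue F v) y.
Proof.
move=> xy; apply: val_inj => /=; apply/eqP.
by rewrite /to_residue -Quotient.idealrBE.
Qed.

Lemma labs_embed (x : F) : x != 0 -> labs (embed (Fin v) x) = 2 ^ (- v x).
Proof. by move=> /negPf x0; rewrite /labs cabs_embed /= /fabs x0. Qed.

Lemma labs_exprz (x : Fv) (m : int) : x != 0 -> labs (x ^ m) = labs x ^ m.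
Proof.
move=> x0.
have labsX n : labs (x ^+ n) = labs x ^+ n.
  by elim: n => [|n IH]; [exact: cabs1|rewrite !exprS -IH; exact: cabsM].
case: m => n; first exact: labsX.
by rewrite !NegzE -!exprnN labsV ?expf_neq0 // labsX.
Qed.

(** By the ultrametric inequality, an element of [F] closer to [x] than [labs x] has the same
    absolute value as [x]. *)
Lemma labs_value (x : Fv) : x != 0 -> exists m : int, labs x = 2 ^ m.
Proof.
move=> x0; have [a xa] := completion_dense x (labs_gt0 x0).
have ax : labs (embed (Fin v) a) = labs x.
  have {}xa : labs (x - embed (Fin v) a) < labs x := xa.
  have ax : labs (embed (Fin v) a - x) < labs x by rewrite -opprB /labs cabsN.
  have h1 := labs_ultra (embed (Fin v) a) (x - embed (Fin v) a).
  have h2 := labs_ultra x (embed (Fin v) a - x).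
  rewrite addrC subrK le_max [X in _ || X]leNgt xa orbF in h1.
  rewrite addrC subrK le_max in h2.
  by apply/eqP; rewrite eq_le h1; case/orP: h2 => [->//|/le_trans->//]; exact: ltW.
have a0 : a != 0.
  apply: contra_eq_neq ax => ->; rewrite rmorph0 /labs cabs0 eq_sym.
  by rewrite gt_eqF ?labs_gt0.
by exists (- v a); rewrite -ax labs_embed.
Qed.

Lemma uniformiser_decomp (pi : F) (p x : unit_group Fv) :
  v pi = 1 -> uval p = embed (Fin v) pi ->
  exists b (m : int), labs (uval b) = 1 /\ x = b + p *~ m.
Proof.
move=> pi1 ppi; have pi0 : pi != 0.
  by apply: contra_eq_neq pi1 => ->; rewrite fval0 eq_sym oner_eq0.
have [m xm] := labs_value (uval_neq0 x).
(* Here [labs x] is [2 ^ m] and [p] has absolute value 1/2, so the [m]-th power of [p] normalises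
   [x]. *)
exists (x + p *~ m), (- m); split; last by rewrite mulrNz addrK.
rewrite uvalD uval_mulrz [LHS]cabsM [cabs _]xm [cabs _]labs_exprz ?uval_neq0 //.
rewrite ppi labs_embed // pi1 exprz_exp mulN1r -expfzDr ?subrr ?expr0z //.
by rewrite pnatr_eq0.
Qed.

End Local.

(** * Ideles *)

Section Ideles.
Context (F : fieldType).

Lemma to_class_zmod : zmod_morphism (@to_class F).
Proof. by move=> x y; rewrite /to_class raddfB. Qed.

HB.instance Definition _ := GRing.isZmodMorphism.Build (idele F) (idele_class F)
  (@to_class F) to_class_zmod.

Lemma to_class_principal (x : idele F) (a : F) : a != 0 ->
  (forall v, uval (x v) = embed v a) -> to_class x = 0.
Proof.
move=> a0 xa; have -> : (0 : idele_class F) = to_class 0 by rewrite raddf0.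
have : x - 0 \in @principal F by rewrite subr0; apply/asboolP; exists a.
by rewrite Quotient.idealrBE => /eqP.
Qed.

Lemma icompB (x y : idele F) v : (x - y) v = x v - y v.
Proof. by []. Qed.

Lemma local_idele_eq (v : place F) (a : unit_group (local_field v)) :
  local_idele a v = a.
Proof. exact: dfwithin. Qed.

Lemma local_idele_neq (v w : place F) (a : unit_group (local_field v)) :
  v != w -> local_idele a w = 0.
Proof. by move=> vw; rewrite /icomp /= dfwithout. Qed.

Lemma local_idele_zmod (v : place F) : zmod_morphism (@local_idele F v).
Proof.
move=> a b; apply: val_inj; apply: functional_extensionality_dep => w.
rewrite -[LHS]/(local_idele (a - b) w).
rewrite -[RHS]/((local_idele a - local_idele b) w) icompB.
have [<-|vw] := eqVneq v w; first by rewrite !local_idele_eq.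
by rewrite !local_idele_neq // subr0.
Qed.

HB.instance Definition _ (v : place F) :=
  GRing.isZmodMorphism.Build (unit_group (local_field v)) (idele F)
    (@local_idele F v) (@local_idele_zmod v).

Lemma S_unit_at (S : set (place F)) (v : fplace F) a :
  S_units S a -> ~ S (Fin v) -> unit_at v a.
Proof.
move=> [a0 ai aVi] vS; have {}vS : Fin v \notin S by rewrite notin_setE.
by split; [exact: a0|exact: (ai (Outside vS))|exact: (aVi (Outside vS))].
Qed.

(** At finite places, only the finitely many in [S] can give [a] an absolute value other than 1. *)
Lemma S_unit_idele (S : set (place F)) a : finite_set S -> S_units S a ->
  exists x : idele F, forall v, uval (x v) = embed v a.
Proof.
move=> Sfin aS; have a0 : a != 0 by case: aS.
have au v : embed v a \is a GRing.unit by rewrite unitfE fmorph_eq0.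
pose x : prod_group (fun v : place F => unit_group (local_field v)) :=
  fun v => UnitGroup (au v).
have xP : x \in @idele_pred F.
  apply/asboolP; apply: (@sub_finite_set _ _ ((@Fin F) @^-1` S)).
    by move=> v /=; apply: contra_notP => /(S_unit_at aS)/unit_atP[].
  by apply: finite_preimage Sfin => v w _ _ [].
by exists (Idele xP).
Qed.

(** * Values of the induced morphism on local ideles *)

Section Induced.
Context (S : set (place F)) (H : zmodType).
Context (rhoS : ohat S -> H) (rho : {additive idele_class F -> H}).
Context (rhoP : induced_by rhoS rho).

Lemma Fin_outside_eq (v w : outside S) : (Fin v == Fin w :> place F) = (v == w).
Proof. by apply/eqP/eqP => [[/val_inj]|->]. Qed.

Lemma induced_by_vunit (v : outside S) (b : unit_group (local_field (Fin v))) :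
  labs (uval b) = 1 ->
  rho (to_class (local_idele b)) = rhoS (dfwith (0 : ohat S) v (to_vunit (uval b))).
Proof.
move=> b1; have cE (w : outside S) : v != w -> local_idele b (Fin w) = 0.
  by move=> vw; rewrite local_idele_neq ?Fin_outside_eq.
rewrite rhoP => [|w]; last first.
  have [<-|vw] := eqVneq v w.
    by have [y yb] := labs1_vunit b1; exists y; rewrite local_idele_eq.
  by exists 0; rewrite cE.
congr rhoS; apply: functional_extensionality_dep => w; rewrite /S_proj.
have [<-|vw] := eqVneq v w; first by rewrite local_idele_eq dfwithin.
by rewrite cE // dfwithout //; exact: to_vunit1.
Qed.

(** The local idele need not lie in [S_ideles]. Dividing by the principal idele of [pi] keeps its
    class and gives component 1 at [v] and the unit [pi^-1] at the other places outside [S], which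
    is [iota_hat v pi]. *)
Lemma induced_by_uniformiser (v : outside S) (pi : F)
    (p : unit_group (local_field (Fin v))) :
  finite_set S -> S_units (S `|` [set Fin v]) pi ->
  uval p = embed (Fin v) pi ->
  rho (to_class (local_idele p)) = rhoS (iota_hat v pi).
Proof.
move=> Sfin piS ppi; have pi0 : pi != 0 by case: piS.
have [|x xpi] := S_unit_idele _ piS.
  by rewrite finite_setU; split; last exact: finite_set1.
have x0 := to_class_principal pi0 xpi.
have -> : to_class (local_idele p) = to_class (local_idele p - x).
  by rewrite raddfB /= x0 subr0.
have xv : (local_idele p - x) (Fin v) = 0.
  rewrite icompB local_idele_eq; apply/eqP; rewrite subr_eq0; apply/eqP.
  by apply: val_inj; rewrite /= ppi xpi.
have xw (w : outside S) : v != w ->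
    uval ((local_idele p - x) (Fin w)) = embed (Fin w) pi^-1.
  move=> vw; rewrite icompB local_idele_neq ?Fin_outside_eq // sub0r.
  by rewrite fmorphV -xpi.
have piw (w : outside S) : v != w -> labs (embed (Fin w) pi^-1) = 1.
  move=> vw; suff /unit_atV/unit_atP[] : unit_at w pi by [].
  apply: S_unit_at piS _ => -[|/= [] /val_inj wv].
    by have := ovalP w; rewrite notin_setE.
  by rewrite wv eqxx in vw.
rewrite rhoP => [|w]; last first.
  have [<-|vw] := eqVneq v w; first by exists 0; rewrite xv.
  by have [y yb] := labs1_vunit (piw _ vw); exists y; rewrite xw.
congr rhoS; apply: functional_extensionality_dep => w.
rewrite /S_proj /iota_hat eq_sym.
have [<-|vw] := eqVneq v w; first by rewrite xv; exact: to_vunit1.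
by rewrite xw.
Qed.

End Induced.
End Ideles.

(** * Reduction at finitely many places *)

Section Reduce.
Context (F : fieldType) (S : set (place F)) (I : finType) (x : I -> outside S).
Context (e : nat).
Local Notation A := (fun i => unit_group (residue (x i)) : zmodType).

Lemma reduce_zmod : zmod_morphism (reduce x e : ohat S -> residue_tensor x e).
Proof.
move=> y z; rewrite /reduce -raddfB; congr to_tensorZ.
by apply: functional_extensionality_dep => i; exact: raddfB.
Qed.

HB.instance Definition _ := GRing.isZmodMorphism.Build (ohat S)
  (residue_tensor x e) (reduce x e) reduce_zmod.

Context (x_inj : injective x).

Lemma reduce_dfwith i (y : unit_group (vring (x i))) :
  reduce x e (dfwith (0 : ohat S) (x i) y) =
  @tensor_inj I A e i (unit_map (@to_residue F (x i)) y).
Proof.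
rewrite /reduce /tensor_inj; congr to_tensorZ.
apply: functional_extensionality_dep => j; rewrite /pg_inj.
have [<-|ij] := eqVneq i j; first by rewrite !dfwithin.
by rewrite !dfwithout ?(inj_eq x_inj) // [LHS]raddf0.
Qed.

(** Units lift from each residue field; since the places are distinct, the lifts can be put at their
    own places and added. *)
Lemma reduce_surj (h : residue_tensor x e) : exists y, reduce x e y = h.
Proof.
have [p ->] := to_tensorZ_surj h.
pose y i := projT1 (cid (unit_residue_lift (p i))).
have yE i : unit_map (@to_residue F (x i)) (y i) = p i.
  exact: projT2 (cid (unit_residue_lift (p i))).
exists (\sum_i (dfwith (0 : ohat S) (x i) (y i) : ohat S)).
rewrite raddf_sum tensor_decomp; apply: eq_bigr => i _ /=.
by rewrite reduce_dfwith yE.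
Qed.

(** Reduction of units is constant on open balls of radius 1, and only finitely many places
    matter. *)
Lemma reduce_continuous : ohat_continuous (reduce x e).
Proof.
move=> y; exists (range x), 1; split=> //; first exact: finite_image.
move=> z yz; rewrite /reduce; congr to_tensorZ.
apply: functional_extensionality_dep => i.
by apply: unit_map_residue_eq; apply: yz; exists i.
Qed.

(** The generators are [e]-th powers in the residue field, hence so are products of their integer
    powers. *)
Lemma T_one_S_units (J : finType) (gamma : J -> F) (v : outside S) (a : F) :
  generates gamma (S_units S) -> T_one e (range gamma) v -> S_units S a ->
  exists z : unit_group (residue v), unit_residue v a = z *+ e.
Proof.
move=> [_ gen] [_ vT] /gen[n ->].
have gT j : unit_at v (gamma j) /\ exists z : unit_group (residue v),
    unit_residue v (gamma j) = z *+ e.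
  by apply: vT; exists j.
have gX j : unit_at v (gamma j ^ n j) /\
    exists z : unit_group (residue v), unit_residue v (gamma j ^ n j) = z *+ e.
  have [gu [z gz]] := gT j.
  have gX m : unit_residue v (gamma j ^+ m) = z *+ m *+ e.
    by rewrite (unit_residueX m gu) gz; exact: mulrnAC.
  case: (n j) => m.
    by split; [exact: unit_atX|exists (z *+ m); exact: gX].
  rewrite NegzE -exprnN; split; first by apply: unit_atV; exact: unit_atX.
  by exists (- (z *+ m.+1)); rewrite (unit_residueV (unit_atX _ gu)) gX mulNrn.
have [|_ ->] := @unit_residue_prod F v J predT (fun j => gamma j ^ n j).
  by move=> j _; have [] := gX j.
have /choice[z hz] j := (gX j).2.
by exists (\sum_j z j); rewrite -sumrMnl; apply: eq_bigr => j _; exact: hz.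
Qed.

Lemma residue_tensor_basis (X : set F) : (0 < e)%N ->
  (forall i, T_one e X (x i)) ->
  exists g : forall i, unit_group (residue (x i)),
    (forall i, spans_mod e (g i)) /\
    basis_mod e [set: residue_tensor x e] (fun i => @tensor_inj I A e i (g i)).
Proof.
move=> e0 xT.
have ex i : exists g : unit_group (residue (x i)), spans_mod e g /\ free_mod e g.
  have [g gs gf] := unit_group_cyclic_mod e0 (xT i).1; by exists g.
exists (fun i => projT1 (cid (ex i))); have gP i := projT2 (cid (ex i)).
split=> [i|]; first exact: (gP i).1.
by apply: tensor_basis => // i; [exact: (gP i).1|exact: (gP i).2].
Qed.

(** Finiteness is read off a basis; [S]-units vanish because they are [e]-th powers in each residue
    field. *)
Lemma reduce_characteristic (J : finType) (gamma : J -> F) : (0 < e)%N ->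
  generates gamma (S_units S) -> (forall i, T_one e (range gamma) (x i)) ->
  characteristic_morphism (reduce x e : ohat S -> residue_tensor x e).
Proof.
move=> e0 gen xT; split.
- have [g [_ [_ gb]]] := residue_tensor_basis e0 xT.
  apply: (@sub_finite_set _ _ (range (fun c : {ffun I -> 'I_e} =>
    \sum_i @tensor_inj I A e i (g i) *+ c i))); last exact: finite_image.
  move=> h _.
  by have [//|c [-> _]] := gb h; exists c.
- exact: reduce_zmod.
- exact: reduce_continuous.
- exact: reduce_surj.
- move=> a y aS ya; apply/to_tensorZ_eq0.
  have ex i : exists z : unit_group (residue (x i)),
      unit_map (@to_residue F (x i)) (y (x i)) = z *+ e.
    by rewrite (unit_residueE (ya (x i))); exact: T_one_S_units gen (xT i) aS.
  exists (fun i => projT1 (cid (ex i))).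
  apply: functional_extensionality_dep => i; rewrite pg_mulrnE.
  exact: projT2 (cid (ex i)).
Qed.

End Reduce.

(** * Single components of the reduction *)

Section ComponentResidue.
Context (F : fieldType) (S : set (place F)) (w : outside S).

Definition component_residue (y : ohat S) : unit_group (residue w) :=
  unit_map (@to_residue F w) (y w).

Lemma component_residue_zmod : zmod_morphism component_residue.
Proof. by move=> y z; exact: raddfB. Qed.

HB.instance Definition _ := GRing.isZmodMorphism.Build (ohat S)
  (unit_group (residue w)) component_residue component_residue_zmod.

(** The sign comes from the components [pi^-1] of [iota_hat] away from [v]. *)
Lemma component_residue_iota (v : outside S) (pi : F) : w <> v ->
  unit_at w pi -> component_residue (iota_hat v pi) = - unit_residue w pi.
Proof.
move=> /eqP wv piw; rewrite /component_residue /iota_hat (negPf wv).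
exact: unit_residueV.
Qed.

End ComponentResidue.

Lemma reduce_eq_component (F : fieldType) (S : set (place F)) (I : finType)
    (x : I -> outside S) (e : nat) (y z : ohat S) (i : I) :
  reduce x e y = reduce x e z ->
  exists t : unit_group (residue (x i)),
    component_residue (x i) (y - z) = t *+ e.
Proof.
move=> yz; have h : reduce x e (y - z) = 0 by rewrite raddfB /= yz subrr.
have [t ht] := (to_tensorZ_eq0 _ _).1 h.
exists (t i).
exact: etrans (congr1 (fun p : prod_group _ => p i) ht) (pg_mulrnE t e i).
Qed.

(** * The basis of [G'] adapted to the local images *)

Theorem theorem2p10 (K : fieldExtType rat) (t : nat) (alpha : 'I_t -> K)
    (G : finZmodType) (S : set (place K))
    (S_finite : finite_set S)
    (S_arch : forall w, S (Arch w))
    (S_pid : is_pid (S_integers S))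
    (alpha_unit : forall i, S_units S (alpha i))
    (psi : {additive idele_class K -> G})
    (psi_continuous : idele_continuous (fun x => psi (to_class x)))
    (L : splittingFieldType K) (L_psi : class_field_of psi L)
    (alpha_norm : forall i, exists y : idele L,
       idele_norm y (fun v => embed v (alpha i)))
    (psi_unramified : unramified_outside S psi)
    (r : nat) (gamma : 'I_r.+1 -> K)
    (gamma_gen : generates gamma (S_units S))
    (e k : nat) (k_gt0 : (0 < k)%N)
    (v : 'I_k -> outside S) (v_inj : injective v)
    (v_T : forall i, T_spl e psi (range gamma) (v i))
    (pi : 'I_k -> K)
    (pi_unit : forall i, S_units (S `|` [set Fin (v i)]) (pi i))
    (pi_unif : forall i, fval (v i) (pi i) = 1)
    (w : 'I_k -> outside S) (u : 'I_k -> K)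
    (u_def : forall j : 'I_k, exists c : 'I_k -> nat,
       [/\ forall l : 'I_k, (l < j)%N -> (c l < e)%N,
           u j = \prod_(l < k | (l < j)%N) pi l ^- c l
         & let wj := fun l : {l : 'I_k | (l < j)%N} => w (val l) in
           reduce wj e (iota_hat (v j) (pi j)) =
           reduce wj e (\sum_(l < k | (l < j)%N) iota_hat (v l) (pi l) *+ c l)])
    (w_T : forall j : 'I_k, T_irr e (range gamma) (u j * pi j) (w j))
    (w_neq_v : forall i j : 'I_k, w j <> v i)
    (w_neq_w : forall l j : 'I_k, (l < j)%N -> w j <> w l) :
  let vw := fun i : 'I_k * bool => if i.2 then w i.1 else v i.1 in
  let G' := residue_tensor vw e in
  let rhoS : ohat S -> G' := reduce vw e in
  characteristic_morphism rhoS /\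
  forall rho : {additive idele_class K -> G'}, induced_by rhoS rho ->
    exists E : 'I_k * bool -> G',
      basis_mod e [set: G'] E /\
      forall i, basis_mod e
        [set rho (to_class (local_idele a))
          | a in [set: unit_group (local_field (Fin (v i)))]]
        (fun b => E (i, b)).
Proof.
move=> vw G' rhoS.
(* Since [k > 0], there is a first place [w_1], and the irreducible polynomial there forces
   [e > 0]. *)
have e0 : (0 < e)%N.
  by have [_ _] := w_T (Ordinal k_gt0); exact: irreducible_XnsubC_gt0.
have w_inj : injective w.
  move=> i j wij; apply/val_inj; case: (ltngtP i j) => // ij.
    by case: (w_neq_w _ _ ij).
  by case: (w_neq_w _ _ ij).
have vw_inj : injective vw.
  move=> [i []] [j []] /= h; first by rewrite (w_inj i j h).
  - by case: (w_neq_v j i).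
  - by case: (w_neq_v i j).
  - by rewrite (v_inj i j h).
have vw_T i : T_one e (range gamma) (vw i).
  by case: i => i [] /=; [case: (w_T i)|case: (v_T i)].
split; first exact: (reduce_characteristic vw_inj e0 gamma_gen vw_T).
move=> rho rhoP.
have [g [gs gb]] := residue_tensor_basis e0 vw_T.
pose A (i : 'I_k * bool) : zmodType := unit_group (residue (vw i)).
(* The index [(i, false)] carries [e_i] and [(i, true)] carries [e_i']. *)
pose E (i : 'I_k * bool) : G' := if i.2 then rhoS (iota_hat (v i.1) (pi i.1))
  else @tensor_inj _ A e _ (g i).
have E_e i : E i *+ e = 0 by exact: tensorZ_mulrn.
have pi_w i j : unit_at (w j) (pi i).
  apply: S_unit_at (pi_unit i) _ => -[|/= [] /val_inj /w_neq_v//].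
  by have := ovalP (w j); rewrite notin_setE.
have E_span (x : G') : x \in spanned E.
  apply: (@triangular_span k e A) => [i z|j].
    have [n ->] := @tensor_inj_spans _ A e (i, false) _ (gs _) z.
    exact/rpredMn/(spanned_gen E (i, false)).
  have [c [_ uj wj]] := u_def j.
  (* [y] lifts [e_j' - sum_{l < j} c_l e_l'] to [ohat S]. *)
  pose y : ohat S := iota_hat (v j) (pi j) -
    \sum_(l < k | (l < j)%N) iota_hat (v l) (pi l) *+ c l.
  exists (fun i => unit_map (@to_residue K (vw i)) (y (vw i))); split.
  - rewrite -[X in X \in _]/(reduce vw e y) /y raddfB raddf_sum rpredB //=.
      exact: (spanned_gen E (j, true)).
    apply: rpred_sum => l _; rewrite raddfMn; apply: rpredMn.
    exact: (spanned_gen E (l, true)).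
  (* The congruence defining the [c l] is triangularity at the earlier [w l]. *)
  - move=> l lj; exact: (reduce_eq_component (exist _ l lj) wj).
  apply: spans_modN.
  have -> : - unit_map (@to_residue K (vw (j, true))) (y (vw (j, true))) =
      unit_residue (w j) (u j * pi j).
    rewrite -[unit_map _ _]/(component_residue (w j) y).
    have [|uu ur] := @unit_residue_prod K (w j) 'I_k (fun l => l < j)%N
        (fun l => pi l ^- c l).
      by move=> l _; apply/unit_atV/unit_atX.
    rewrite -uj in uu ur; rewrite (unit_residueM uu (pi_w j j)) ur.
    rewrite /y raddfB raddf_sum /= (component_residue_iota (w_neq_v _ _) (pi_w j j)).
    rewrite opprB opprK; congr (_ + _); apply: eq_bigr => l _.
    rewrite raddfMn /= (component_residue_iota (w_neq_v _ _) (pi_w l j)).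
    rewrite (unit_residueV (unit_atX _ (pi_w l j))) (unit_residueX _ (pi_w l j)).
    exact: mulNrn.
  (* The primitive root at [w j] serves as the reference generator. *)
  have [_ _] := w_T j; apply: irreducible_spans_mod; exact: (gs (j, true)).
have E_basis : basis_mod e [set: G'] E.
  by apply: spanning_basis_mod gb _ => x; apply: spanned_mod.
exists E; split=> // i.
have piu : embed (Fin (v i)) (pi i) \is a GRing.unit.
  by rewrite unitfE fmorph_eq0; case: (pi_unit i).
pose p : unit_group (local_field (Fin (v i))) := UnitGroup piu.
have rho_p : rho (to_class (local_idele p)) = E (i, true).
  exact: (induced_by_uniformiser rhoP S_finite (pi_unit i) (erefl (uval p))).
have rho_unit (b : unit_group (local_field (Fin (v i)))) : labs (uval b) = 1 ->
    rho (to_class (local_idele b)) = @tensor_inj _ A e (i, false)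
      (unit_map (@to_residue K (v i)) (to_vunit (uval b))).
  move=> b1; rewrite (induced_by_vunit rhoP b1).
  exact: (@reduce_dfwith K S _ vw e vw_inj (i, false)).
apply: basis_mod_fiber => // [b|x [a _ <-]].
  (* [e_i'] is the image of [pi i] in the completion, and [e_i] that of a unit lifting the primitive
     root. *)
  case: b; first by exists p.
  have [y yg] := unit_residue_lift (g (i, false)).
  have y1 := vunit_labs y.
  have yu : vr_val (uval y) \is a GRing.unit by rewrite unitfE labs_neq0.
  by exists (UnitGroup yu) => //; rewrite rho_unit //= to_vunitK yg.
apply: spanned_mod => //.
(* The unit [b] contributes a multiple of [e_i], and the power of [p] a multiple of [e_i']. *)
have [b [m [b1 ->]]] := uniformiser_decomp a (pi_unif i) (erefl (uval p)).
rewrite !raddfD /= rpredD //.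
  rewrite rho_unit //.
  have [n ->] := @tensor_inj_spans _ A e (i, false) _ (gs _)
    (unit_map (@to_residue K (v i)) (to_vunit (uval b))).
  exact/rpredMn/(spanned_gen (fun b => E (i, b)) false).
rewrite !raddfMz /= rho_p.
exact/rpredMz/(spanned_gen (fun b => E (i, b)) true).
Qed.
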